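(* Let $\ell$ be a positive integer. Let $X_1,\dots,X_\ell$ be subvarieties of $\mathbb{P}^n$ whose linear spans are generic of dimensions $h_1,\dots,h_\ell$, respectively, and assume $n\geq (h_1+1)\cdots(h_\ell+1)-1$. If $X_1,\dots,X_\ell$ are non-singular, then $X_1\star\cdots\star X_\ell$ is also non-singular.
   Context: The base field $\mathbb{K}$ is algebraically closed of characteristic $0$; all varieties are irreducible (closed subvarieties of projective space). Hadamard product: for subvarieties $X_1,\dots,X_\ell\subseteq\mathbb{P}^n$, $X_1\star\cdots\star X_\ell$ is the Zariski closure in $\mathbb{P}^n$ of the image of the rational map $X_1\times\cdots\times X_\ell\dashrightarrow\mathbb{P}^n$ given by coordinatewise multiplication of homogeneous coordinates (for $\ell=2$: $([a_0:\dots:a_n],[b_0:\dots:b_n])\mapsto[a_0b_0:a_1b_1:\dots:a_nb_n]$). Genericity: ''the linear spans are generic of dimensions $h_1,\dots,h_\ell$'' means that the tuple $(L_1,\dots,L_\ell)$ of linear spans ($L_i$ a linear subspace of $\mathbb{P}^n$ of dimension $h_i$) lies in a suitable nonempty Zariski-open subset, depending only on $n,h_1,\dots,h_\ell$, of the space of all such tuples (parameterized by the coefficients of linear parametric equations of the $L_i$). For tuples in this open set the assertion holds for all subvarieties $X_i$ with linear span $L_i$. *)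

(* Defs.v *)
From mathcomp Require Import all_boot all_order all_algebra.
From mathcomp Require Import mpoly.

Set Implicit Arguments.
Unset Strict Implicit.
Unset Printing Implicit Defensive.

Import GRing.Theory.
Local Open Scope ring_scope.

Section ProjectiveGeometry.

Variables (K : closedFieldType) (n : nat).

(* A subset of P^n is given by the set of all its homogeneous coordinate
   vectors: nonzero vectors of K^(n+1), closed under nonzero scaling.  Both
   conditions hold for every set satisfying [proj_closed], and for
   [hadamard_image X] when l > 0 and the X i are such sets. *)
Definition projset := 'rV[K]_n.+1 -> Prop.

Implicit Types X Y Z : projset.

Definition psub X Y := forall x, X x -> Y x.

Definition psubset X Y := psub X Y /\ ~ psub Y X.

Definition is_form (p : {mpoly K[n.+1]}) := exists d, p \is d.-homog.

Definition proj_closed X :=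
  exists2 F : {mpoly K[n.+1]} -> Prop,
    forall p, F p -> is_form p &
    forall x, X x <-> x != 0 /\ forall p, F p -> p.@[x 0] = 0.

Definition proj_closure X : projset :=
  fun x => forall Z, proj_closed Z -> psub X Z -> Z x.

Definition proj_variety X :=
  [/\ proj_closed X, exists x, X x &
      forall Y Z, proj_closed Y -> proj_closed Z ->
        (forall x, X x -> Y x \/ Z x) -> psub X Y \/ psub X Z].

Definition has_chain X d :=
  exists Z : nat -> projset,
    [/\ forall i, (i <= d)%N -> proj_variety (Z i),
        forall i, (i < d)%N -> psubset (Z i) (Z i.+1) &
        psub (Z d) X].

(* Krull dimension of X as a topological space. *)
Definition has_dim X d :=
  has_chain X d /\ forall e, has_chain X e -> (e <= d)%N.

(* The forms in the homogeneous ideal I(X); they generate it. *)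
Definition vanishing_form X (p : {mpoly K[n.+1]}) :=
  is_form p /\ forall x, X x -> p.@[x 0] = 0.

(* Vectors of K^(n+1) over the embedded projective tangent space T_x X of P^n,
   together with 0. *)
Definition tangent X (x v : 'rV[K]_n.+1) :=
  forall p, vanishing_form X p -> \sum_j (p^`M(j)).@[x 0] * v 0 j = 0.

(* T_x X has projective dimension dim X at every point x of X, i.e. the
   underlying vector space has dimension dim X + 1 (the Jacobian criterion). *)
Definition nonsingular X :=
  exists2 d, has_dim X d &
    forall x, X x ->
      exists2 T : 'M[K]_n.+1, \rank T = d.+1 &
        forall v : 'rV[K]_n.+1, (v <= T)%MS <-> tangent X x v.

(* The linear span of X is the linear subspace P(row space of A). *)
Definition has_linear_span X m (A : 'M[K]_(m, n.+1)) :=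
  (forall x, X x -> (x <= A)%MS) /\
  (forall k (B : 'M[K]_(k, n.+1)),
     (forall x, X x -> (x <= B)%MS) -> (A <= B)%MS).

Definition hadamard_point l (x : 'I_l -> 'rV[K]_n.+1) : 'rV[K]_n.+1 :=
  \row_j \prod_(i < l) x i 0 j.

Definition hadamard_image l (X : 'I_l -> projset) : projset :=
  fun y => y != 0 /\
    exists2 x : 'I_l -> 'rV[K]_n.+1,
      forall i, X i (x i) & y = hadamard_point x.

Definition hadamard l (X : 'I_l -> projset) : projset :=
  proj_closure (hadamard_image X).

End ProjectiveGeometry.

Section Genericity.

Variables (K : closedFieldType) (n l : nat) (h : 'I_l -> nat).

(* Coefficients of linear parametric equations of a tuple (L_1, .., L_l): L_i is
   the row space of A i, and has projective dimension h i when A i has full row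
   rank. *)
Definition param_tuple := forall i : 'I_l, 'M[K]_((h i).+1, n.+1).

Definition span_tuple (A : param_tuple) := forall i, row_free (A i).

Definition param_coords (A : param_tuple) :
    'rV[K]_((\sum_(i < l) (h i).+1) * n.+1) :=
  mxvec (\mxcol_i A i).

Definition param_open (U : param_tuple -> Prop) :=
  exists F : {mpoly K[(\sum_(i < l) (h i).+1) * n.+1]} -> Prop,
    forall A, U A <-> exists2 p, F p & p.@[param_coords A 0] != 0.

(* P holds for the tuples (L_1, .., L_l) in a nonempty Zariski-open subset of
   the space of all tuples of linear subspaces of dimensions h i. *)
Definition generically (P : param_tuple -> Prop) :=
  exists U : param_tuple -> Prop,
    [/\ param_open U,
        exists2 A, span_tuple A & U A &
        forall A, span_tuple A -> U A -> P A].

End Genericity.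

(* Main.v *)
From Stdlib Require Import Classical.
Require Import Defs.
From mathcomp Require Import all_boot all_order all_algebra.
From mathcomp Require Import mpoly ring.

Set Implicit Arguments.
Unset Strict Implicit.
Unset Printing Implicit Defensive.

Import GRing.Theory.
Local Open Scope ring_scope.

(** Put N + 1 = (h_1 + 1) ... (h_l + 1).  Expanding the coordinatewise product of
    u_1 A_1, .., u_l A_l by multilinearity shows that it is the Segre tensor
    u_1 (x) .. (x) u_l followed by the linear map whose matrix [segre_mx A] has
    the coordinatewise products of one row from each A_i as its N + 1 rows.  For
    generic A these rows are linearly independent ([segre_open],
    [segre_coordinate]; this needs N <= n), so the Hadamard product of the X_i is
    a linearly embedded copy of their Segre product, and all that is used of the
    Segre embedding is that linear maps recover the factors of a point from it
    ([recovers_factors], [segre_recovers]).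

    It remains to see that such a product Y is non-singular of dimension
    D = d_1 + .. + d_l, where d_i = dim X_i.  Writing down equations shows that
    the image is already closed ([hadamard_image_closed]), and it is irreducible
    when the factors are ([hadamard_image_variety]).  Products of the members of
    chains in the X_i form a chain of length D in Y ([hadamard_chain]).
    Differentiating the equations shows that the tangent space of Y at the
    product of the points x_i is the sum of the images of the tangent spaces of
    the factors; these meet only in the line of the point, so the rank of the
    sum is D + 1 ([hadamard_tangent]).

    That no chain in Y is longer than D is deduced from the tangent spaces
    ([chain_lt_tangent]).  Let I be the ideal of the top member Z of a chain of
    length e.  Along the chain of prime ideals the number of coordinates that
    are algebraically independent modulo the ideal grows at each step
    ([independent_grow]), which gives e + 1 coordinates independent modulo I.
    Once these are enlarged to a maximal independent family, the at most n - e
    remaining coordinates are algebraic over it modulo I, and their minimal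
    relations g generate I at a general point of Z: each f in I has a multiple
    h f in the ideal of the g with h outside I ([ideal_relations]).  So the Jacobian rank of Z at a general point is at
    most n - e, the tangent space of Y there has rank at least e + 1, and
    e <= D. *)

(** * Algebraic elements modulo a prime ideal *)

Section Elimination.

Variable R : comNzRingType.

Record prime_ideal (I : R -> Prop) : Prop := PrimeIdeal {
  pideal0 : I 0;
  pidealD : forall a b, I a -> I b -> I (a + b);
  pidealM : forall a b, I b -> I (a * b);
  pideal1 : ~ I 1;
  pidealP : forall a b, I (a * b) -> I a \/ I b }.

Record subring (A : R -> Prop) : Prop := Subring {
  subring1 : A 1;
  subringB : forall a b, A a -> A b -> A (a - b);
  subringM : forall a b, A a -> A b -> A (a * b) }.

Definition poly_over (A : R -> Prop) (q : {poly R}) := forall i, A q`_i.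

Definition adjoin (A : R -> Prop) (x : R) : R -> Prop :=
  fun f => exists2 q, poly_over A q & f = q.[x].

(** Algebraicity over the image of A in the quotient by I, without forming the
    quotient: some coefficient of the relation must survive there. *)
Definition algebraic_mod (I A : R -> Prop) (x : R) :=
  exists q, [/\ poly_over A q, I q.[x] & exists k, ~ I q`_k].

Lemma subring0 A : subring A -> A 0.
Proof. by case=> A1 AB _; rewrite -(subrr 1); apply: AB. Qed.

Lemma subringN A a : subring A -> A a -> A (- a).
Proof. by move=> sA Aa; rewrite -sub0r; apply: (subringB sA) => //; apply: subring0. Qed.

Lemma subringD A a b : subring A -> A a -> A b -> A (a + b).
Proof.
by move=> sA Aa Ab; rewrite -[b]opprK; apply: (subringB sA) => //; apply: subringN.
Qed.

Lemma subringX A a k : subring A -> A a -> A (a ^+ k).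
Proof.
move=> sA Aa; elim: k => [|k IH]; first exact: subring1.
by rewrite exprS; apply: subringM.
Qed.

Lemma subring_sum A (J : Type) (r : seq J) (F : J -> R) :
  subring A -> (forall j, A (F j)) -> A (\sum_(j <- r) F j).
Proof.
move=> sA AF; elim: r => [|j r IH]; first by rewrite big_nil; apply: subring0.
by rewrite big_cons; apply: subringD.
Qed.

Lemma ideal_sum I (J : finType) (P : pred J) (F : J -> R) :
  prime_ideal I -> (forall j, I (F j)) -> I (\sum_(j | P j) F j).
Proof.
by move=> pI IF; apply: big_ind => //; [exact: pideal0 | exact: pidealD].
Qed.

Lemma idealN I a : prime_ideal I -> I a -> I (- a).
Proof. by move=> pI Ia; rewrite -mulN1r; apply: pidealM. Qed.

Lemma idealB I a b : prime_ideal I -> I a -> I b -> I (a - b).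
Proof. by move=> pI Ia Ib; apply: pidealD => //; apply: idealN. Qed.

Lemma notin_idealX I a k : prime_ideal I -> ~ I a -> ~ I (a ^+ k).
Proof.
move=> pI nIa; elim: k => [|k IH]; first exact: pideal1 pI.
by rewrite exprS => /(pidealP pI)[].
Qed.

Section PolyOver.

Variable A : R -> Prop.
Hypothesis sA : subring A.

Lemma poly_overD p q : poly_over A p -> poly_over A q -> poly_over A (p + q).
Proof. by move=> Ap Aq i; rewrite coefD; apply: subringD. Qed.

Lemma poly_overB p q : poly_over A p -> poly_over A q -> poly_over A (p - q).
Proof. by move=> Ap Aq i; rewrite coefB; apply: subringB. Qed.

Lemma poly_overM p q : poly_over A p -> poly_over A q -> poly_over A (p * q).
Proof.
by move=> Ap Aq i; rewrite coefM; apply: subring_sum => // j; apply: subringM.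
Qed.

Lemma poly_overC c : A c -> poly_over A c%:P.
Proof. by move=> Ac i; rewrite coefC; case: eqP => // _; apply: subring0. Qed.

Lemma poly_overXn k : poly_over A 'X^k.
Proof.
by move=> i; rewrite coefXn; case: eqP => _; [exact: (subring1 sA) | exact: (subring0 sA)].
Qed.

Lemma poly_overX : poly_over A 'X.
Proof. by rewrite -['X]expr1; apply: poly_overXn. Qed.

Lemma poly_overZ c q : A c -> poly_over A q -> poly_over A (c *: q).
Proof. by move=> Ac Aq i; rewrite coefZ; apply: subringM. Qed.

Lemma poly_over0 : poly_over A 0.
Proof. by move=> i; rewrite coef0; apply: subring0. Qed.

Lemma adjoin_subring x : subring (adjoin A x).
Proof.
split.
- by exists 1%:P; [apply: poly_overC; apply: subring1 | rewrite hornerC].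
- move=> _ _ [p Ap ->] [q Aq ->]; exists (p - q); first exact: poly_overB.
  by rewrite !hornerE.
move=> _ _ [p Ap ->] [q Aq ->]; exists (p * q); first exact: poly_overM.
by rewrite !hornerE.
Qed.

Lemma adjoin_base x a : A a -> adjoin A x a.
Proof. by move=> Aa; exists a%:P; [apply: poly_overC | rewrite hornerC]. Qed.

Lemma adjoin_gen x : adjoin A x x.
Proof. by exists 'X; [apply: poly_overX | rewrite hornerX]. Qed.

Lemma size_drop_lead (p : {poly R}) : p != 0 ->
  (size (p - lead_coef p *: 'X^((size p).-1))%R < size p)%N.
Proof.
move=> p0; have sp : (0 < size p)%N by rewrite lt0n size_poly_eq0.
rewrite -(prednK sp) ltnS; apply/leq_sizeP => j.
rewrite leq_eqVlt coefB coefZ coefXn => /predU1P[<-|lj].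
  by rewrite eqxx mulr1 subrr.
by rewrite gtn_eqF // mulr0 subr0 nth_default // -(prednK sp).
Qed.

(** The bound on the size of the quotient is what lets [eliminate] compare it
    with a relation of minimal size. *)
Lemma pseudo_division f g : poly_over A f -> poly_over A g -> g != 0 ->
  exists m a r, [/\ poly_over A a, poly_over A r,
    (size r < size g)%N, (size a + size g <= (maxn (size f) (size g)).+1)%N &
    lead_coef g ^+ m *: f = a * g + r].
Proof.
move=> + Ag g0; have sg : (0 < size g)%N by rewrite lt0n size_poly_eq0.
have [n] := ubnP (size f); elim: n f => // n IH f; rewrite ltnS => sfn Af.
have [lt|le] := ltnP (size f) (size g).
  exists 0%N, 0, f; split=> //; first exact: poly_over0.
    by rewrite size_poly0 add0n leqW // leq_maxr.
  by rewrite expr0 scale1r mul0r add0r.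
have f0 : f != 0 by rewrite -size_poly_gt0; apply: leq_trans le.
have sf : (0 < size f)%N by rewrite lt0n size_poly_eq0.
pose k := (size f - size g)%N.
pose f1 := lead_coef g *: f - (lead_coef f *: 'X^k) * g.
have Af1 : poly_over A f1.
  apply: poly_overB; first by apply: poly_overZ => //; apply: Ag.
  apply: poly_overM => //; apply: poly_overZ; first exact: Af.
  exact: poly_overXn.
have sf1 : (size f1 < size f)%N.
  rewrite -(prednK sf) ltnS; apply/leq_sizeP => j.
  rewrite /f1 coefB coefZ -scalerAl coefZ mulrC [_ * g]mulrC coefMXn.
  rewrite leq_eqVlt => /predU1P[<-|lj].
    rewrite ltnNge /k; have -> : (size f - size g <= (size f).-1)%N.
      by rewrite -subn1 leq_sub2l.
    have -> /= : ((size f).-1 - (size f - size g) = (size g).-1)%N.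
      by rewrite -!subn1 subnAC subKn.
    by rewrite subrr.
  have lj' : (size f <= j)%N by rewrite -(prednK sf).
  rewrite nth_default // mul0r sub0r.
  have kj : (k <= j)%N by rewrite (leq_trans _ lj') // leq_subr.
  rewrite ltnNge kj /= nth_default ?mulr0 ?oppr0 //.
  by rewrite leq_subRL // /k subnK.
have [m [a [r [Aa Ar sr sa E]]]] := IH f1 (leq_trans sf1 sfn) Af1.
exists m.+1, (a + (lead_coef g ^+ m * lead_coef f) *: 'X^k), r; split=> //.
- apply: poly_overD => //; apply: poly_overZ; last exact: poly_overXn.
  by apply: (subringM sA); [apply: subringX => //; apply: Ag | apply: Af].
- have sX : (size ((lead_coef g ^+ m * lead_coef f) *: 'X^k : {poly R}) <= k.+1)%N.
    by rewrite (leq_trans (size_scale_leq _ _)) // size_polyXn.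
  rewrite addnC -leq_subRL ?(leqW le) //.
  rewrite (leq_trans (size_polyD _ _)) // geq_max; apply/andP; split.
    rewrite leq_subRL ?(leqW le) // addnC (leq_trans sa) // ltnS geq_max le.
    by rewrite ltnW.
  by rewrite (leq_trans sX) // /k subSn.
rewrite exprSr -scalerA.
have -> : lead_coef g *: f = f1 + (lead_coef f *: 'X^k) * g by rewrite subrK.
by rewrite scalerDr E mulrDl scalerAl scalerA -addrA [r + _]addrC addrA.
Qed.

End PolyOver.

Lemma min_size_poly (P : {poly R} -> Prop) p : P p ->
  exists2 q, P q & forall r, P r -> (size q <= size r)%N.
Proof.
have [n] := ubnP (size p); elim: n p => // n IH p; rewrite ltnS => sp Pp.
have [[q [Pq lt]]|no] := classic (exists q, P q /\ (size q < size p)%N).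
  by apply: IH Pq; apply: leq_trans sp.
exists p => // r Pr; rewrite leqNgt; apply/negP => lt.
by apply: no; exists r.
Qed.

Section OneVariable.

Variables (I A : R -> Prop) (x : R).
Hypotheses (pI : prime_ideal I) (sA : subring A).

(** Removing a leading term whose coefficient lies in I turns a relation into a
    smaller one, so a relation of minimal size has its leading coefficient
    outside I. *)
Lemma minimal_relation : algebraic_mod I A x ->
  exists g, [/\ poly_over A g, I g.[x], ~ I (lead_coef g) &
    forall q, poly_over A q -> I q.[x] -> (size q < size g)%N ->
    forall k, I q`_k].
Proof.
case=> q0 Pq0.
pose P q := [/\ poly_over A q, I q.[x] & exists k, ~ I q`_k].
have [g [Ag Ig [k nIk]] gmin] := @min_size_poly P q0 Pq0.
exists g; split=> //; last first.
  move=> q Aq Iq sq j; apply: NNPP => nI.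
  have Pq : P q by split=> //; exists j.
  by move: (gmin q Pq); rewrite leqNgt sq.
move=> Il.
have g0 : g != 0 by apply: contra_notN nIk => /eqP->; rewrite coef0; apply: pideal0.
pose g' := g - lead_coef g *: 'X^((size g).-1).
have Ag' : poly_over A g'.
  by apply: poly_overB => //; apply: poly_overZ; [| apply: Ag | apply: poly_overXn].
have Pg' : P g'.
  split=> //.
    rewrite hornerD hornerN; apply: idealB => //.
    by rewrite hornerZ mulrC; apply: pidealM.
  exists k; rewrite coefB => Ik; apply: nIk.
  rewrite -[g`_k](subrK (lead_coef g *: 'X^((size g).-1))`_k).
  by apply: pidealD => //; rewrite coefZ mulrC; apply: pidealM.
by move: (gmin _ Pg'); rewrite leqNgt size_drop_lead.
Qed.

(** An element that is nonzero modulo I has a multiple that is nonzero modulo I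
    and comes from A: this is the norm argument, done by Euclid's algorithm.
    Take p over A of minimal size among the polynomials whose value at x is a
    multiple of f modulo I but not in I.  If p were not constant, dividing
    the larger of p and the minimal relation of x by the smaller one would give
    a smaller such polynomial or a smaller relation. *)
Lemma eliminate f : algebraic_mod I A x -> adjoin A x f -> ~ I f ->
  exists c, [/\ A c, ~ I c & exists a b, I b /\ c = b + a * f].
Proof.
case/minimal_relation => g [Ag Ig nIg gmin] [q0 Aq0 fE] nIf.
pose J z := exists a b, I b /\ z = b + a * f.
have JI z : I z -> J z by move=> Iz; exists 0, z; rewrite mul0r addr0.
have JM a z : J z -> J (a * z).
  case=> a' [b [Ib ->]]; exists (a * a'), (a * b).
  by split; [exact: pidealM | rewrite mulrDr mulrA].
have JB y z : J y -> J z -> J (y - z).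
  case=> a [b [Ib ->]] [a' [b' [Ib' ->]]]; exists (a - a'), (b - b').
  by split; [exact: idealB | rewrite mulrBl addrACA opprD].
pose P q := [/\ poly_over A q, J q.[x] & ~ I q.[x]].
have Pq0 : P q0.
  by split; rewrite -?fE //; exists 1, 0; rewrite mul1r add0r; split=> //; apply: pideal0.
have [p [Ap Jp nIp] pmin] := @min_size_poly P q0 Pq0.
have p0 : p != 0 by apply: contra_notN nIp => /eqP->; rewrite horner0; apply: pideal0.
have nIl : ~ I (lead_coef p).
  move=> Il; pose t := lead_coef p *: 'X^((size p).-1).
  have It : I t.[x] by rewrite hornerZ mulrC; apply: pidealM.
  have Ppt : P (p - t).
    split.
    - apply: poly_overB => //; apply: poly_overZ => //; last exact: poly_overXn.
      exact: Ap.
    - by rewrite hornerD hornerN; apply: JB => //; apply: JI.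
    rewrite hornerD hornerN => Ipt; apply: nIp.
    by rewrite -[p.[x]](subrK t.[x]); apply: pidealD.
  by move: (pmin _ Ppt); rewrite leqNgt size_drop_lead.
have [sp1|sp2] := leqP (size p) 1.
  move: Ap Jp nIp; rewrite (size1_polyC sp1) hornerC => Ap Jp nIp.
  by exists p`_0; split=> //; move: (Ap 0%N); rewrite coefC.
have g0 : g != 0 by apply: contra_notN nIg => /eqP->; rewrite lead_coef0; apply: pideal0.
(* If g is smaller than p, the remainder of p by g contradicts the choice of p. *)
have [sgp|spg] := ltnP (size g) (size p).
  have [m [a [r [Aa Ar sr _ E]]]] := pseudo_division sA Ap Ag g0.
  have {}E : lead_coef g ^+ m * p.[x] = a.[x] * g.[x] + r.[x].
    by rewrite -hornerZ E !hornerE.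
  have Pr : P r.
    split=> //.
      have -> : r.[x] = lead_coef g ^+ m * p.[x] - a.[x] * g.[x].
        by rewrite E addrC addKr.
      by apply: JB; [apply: JM | apply: JI; apply: pidealM].
    move=> Ir; have : I (lead_coef g ^+ m * p.[x]).
      by rewrite E; apply: pidealD => //; apply: pidealM.
    by case/(pidealP pI) => //; apply: notin_idealX.
  by move: (pmin _ Pr); rewrite leqNgt (ltn_trans sr).
(* Otherwise the quotient a of g by p is a relation smaller than g, so all its
   coefficients are in I, and so is the leading coefficient of g. *)
have [m [a [r [Aa Ar sr sa E]]]] := pseudo_division sA Ag Ap p0.
have Ex : lead_coef p ^+ m * g.[x] = a.[x] * p.[x] + r.[x].
  by rewrite -hornerZ E !hornerE.
have Ir : I r.[x].
  apply: NNPP => nIr.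
  have Pr : P r.
    split=> //; have -> : r.[x] = lead_coef p ^+ m * g.[x] - a.[x] * p.[x].
      by rewrite Ex addrC addKr.
    by apply: JB; apply: JM => //; apply: JI.
  by move: (pmin _ Pr); rewrite leqNgt sr.
have Ia : I a.[x].
  have : I (a.[x] * p.[x]).
    have -> : a.[x] * p.[x] = lead_coef p ^+ m * g.[x] - r.[x].
      by rewrite Ex addrK.
    by apply: idealB => //; apply: pidealM.
  by case/(pidealP pI).
have Iak : forall k, I a`_k.
  apply: gmin => //; rewrite (maxn_idPl spg) in sa.
  have : (size a + 2 <= (size g).+1)%N by rewrite (leq_trans _ sa) // leq_add2l.
  by rewrite addn2.
have /(congr1 (fun q : {poly R} => q`_(size g).-1)) := E.
rewrite coefZ coefD [r`__]nth_default ?addr0; last first.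
  by move: (leq_trans sr spg); case: (size g).
move=> El; have : I (lead_coef p ^+ m * lead_coef g).
  rewrite /lead_coef in El *; rewrite El coefM; apply: ideal_sum => // j.
  by rewrite mulrC; apply: pidealM.
by case/(pidealP pI) => // /notin_idealX; case.
Qed.

(** Pseudo-division by the minimal relation g: up to a factor outside I, an
    element of I in A[x] is a multiple of g plus a polynomial in x with
    coefficients in I and A, because the remainder is a relation smaller than
    g. *)
Lemma divide_relation : algebraic_mod I A x ->
  exists2 g, I g & forall f, adjoin A x f -> I f ->
  exists h a r, [/\ ~ I h, h * f = a * g + r.[x] &
    forall k : nat, A r`_k /\ I r`_k].
Proof.
case/minimal_relation => g [Ag Ig nIg gmin].
exists g.[x] => // _ [q Aq ->] Iq.
have g0 : g != 0.
  by apply: contra_notN nIg => /eqP->; rewrite lead_coef0; apply: pideal0.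
have [m [a [r [Aa Ar sr _ E]]]] := pseudo_division sA Aq Ag g0.
have {}E : lead_coef g ^+ m * q.[x] = a.[x] * g.[x] + r.[x].
  by rewrite -hornerZ E !hornerE.
exists (lead_coef g ^+ m), a.[x], r; split=> //; first exact: notin_idealX.
move=> k; split=> //; apply: gmin => //.
have -> : r.[x] = lead_coef g ^+ m * q.[x] - a.[x] * g.[x].
  by rewrite E addrC addKr.
by apply: idealB => //; apply: pidealM.
Qed.

End OneVariable.

End Elimination.

(** * Independent elements and relations in towers *)

Section Tower.

Variable R : comNzRingType.

(** The ideal generated by a list, by recursion so that a relation can be added
    at the head. *)
Fixpoint generated (gs : seq R) (z : R) : Prop :=
  if gs is g :: gs' then exists a b, generated gs' b /\ z = a * g + b
  else z = 0.

Lemma generated0 gs : generated gs 0.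
Proof.
elim: gs => //= g gs IH; exists 0, 0; split=> //.
by rewrite mul0r addr0.
Qed.

Lemma generatedD gs y z : generated gs y -> generated gs z -> generated gs (y + z).
Proof.
elim: gs y z => [|g gs IH] y z /=; first by move=> -> ->; rewrite addr0.
move=> [a [b [Gb ->]]] [a' [b' [Gb' ->]]]; exists (a + a'), (b + b').
by split; [exact: IH | rewrite mulrDl addrACA].
Qed.

Lemma generatedM gs a z : generated gs z -> generated gs (a * z).
Proof.
elim: gs z => [|g gs IH] z /=; first by move=> ->; rewrite mulr0.
move=> [a' [b [Gb ->]]]; exists (a * a'), (a * b).
by split; [exact: IH | rewrite mulrDr mulrA].
Qed.

Section Saturation.

Variables (I : R -> Prop) (pI : prime_ideal I).

(** Membership in the ideal generated by gs after localization at I. *)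
Definition saturated gs z := exists2 h, ~ I h & generated gs (h * z).

Lemma saturated0 gs : saturated gs 0.
Proof.
by exists 1; [exact: pideal1 pI | rewrite mulr0; exact: generated0].
Qed.

Lemma saturatedD gs y z : saturated gs y -> saturated gs z -> saturated gs (y + z).
Proof.
move=> [h nh Gy] [k nk Gz]; exists (h * k); first by case/(pidealP pI).
rewrite mulrDr; apply: generatedD; last by rewrite -mulrA; apply: generatedM.
by rewrite [h * k]mulrC -mulrA; apply: generatedM.
Qed.

Lemma saturatedM gs a z : saturated gs z -> saturated gs (a * z).
Proof. by move=> [h nh Gz]; exists h => //; rewrite mulrCA; apply: generatedM. Qed.

End Saturation.

Variables (A0 : R -> Prop) (J : finType) (x : J -> R).
Hypothesis sA0 : subring A0.
Hypothesis genR : forall A : R -> Prop, subring A ->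
  (forall a, A0 a -> A a) -> (forall j, A (x j)) -> forall f, A f.

(** The subring generated by A0 and the x j with j in s, built one element at a
    time so that each step is an [adjoin]. *)
Fixpoint tower (s : seq J) : R -> Prop :=
  if s is j :: s' then adjoin (tower s') (x j) else A0.

Lemma tower_subring s : subring (tower s).
Proof. by elim: s => //= j s IH; apply: adjoin_subring. Qed.

Lemma tower_cat t s f : tower s f -> tower (t ++ s) f.
Proof.
by elim: t => //= j t IH /IH; apply: adjoin_base; apply: tower_subring.
Qed.

Lemma tower_gen s j : j \in s -> tower s (x j).
Proof.
elim: s => //= i s IH; rewrite inE => /predU1P[->|/IH Aj].
  by apply: adjoin_gen; apply: tower_subring.
by apply: adjoin_base => //; apply: tower_subring.
Qed.

Lemma tower_full s f : (forall j, j \in s) -> tower s f.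
Proof.
move=> sP; apply: (genR (tower_subring s)) => [a A0a|j]; last exact: tower_gen.
by rewrite -[s]cats0; apply: tower_cat.
Qed.

Lemma algebraic_sub (I A B : R -> Prop) y : (forall a, A a -> B a) ->
  algebraic_mod I A y -> algebraic_mod I B y.
Proof. by move=> AB [q [Aq Iq nI]]; exists q; split=> // i; apply: AB. Qed.

Lemma eliminate_tower I t s f : prime_ideal I ->
  (forall j, j \in t -> algebraic_mod I (tower s) (x j)) ->
  tower (t ++ s) f -> ~ I f ->
  exists c, [/\ tower s c, ~ I c & exists a b, I b /\ c = b + a * f].
Proof.
move=> pI; elim: t f => [|j t IH] f alg /=.
  move=> Af nIf; exists f; split=> //; exists 1, 0.
  by rewrite add0r mul1r; split=> //; apply: pideal0.
move=> Af nIf.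
have algj : algebraic_mod I (tower (t ++ s)) (x j).
  by apply: algebraic_sub (alg j (mem_head _ _)) => a; apply: tower_cat.
have [c [Ac nIc [a [b [Ib cE]]]]] :=
  eliminate pI (tower_subring _) algj Af nIf.
have [|c' [Ac' nIc' [a' [b' [Ib' c'E]]]]] := IH c _ Ac nIc.
  by move=> i it; apply: alg; rewrite inE it orbT.
exists c'; split=> //; exists (a' * a), (b' + a' * b); split.
  by apply: (pidealD pI) => //; apply: (pidealM pI).
by rewrite c'E cE mulrDr mulrA addrA.
Qed.

Definition independent_mod (I : R -> Prop) s := forall f, tower s f -> I f -> f = 0.

(** Each element of t contributes its minimal relation.  Dividing by the last
    one leaves coefficients in I one level down; at the bottom, independence
    leaves only 0. *)
Lemma tower_relations I t s : prime_ideal I -> independent_mod I s ->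
  (forall j, j \in t -> algebraic_mod I (tower s) (x j)) ->
  exists gs, [/\ size gs = size t, forall g, g \in gs -> I g &
    forall f, tower (t ++ s) f -> I f -> saturated I gs f].
Proof.
move=> pI ind; elim: t => [|j t IH] alg.
  exists [::]; split=> // f Af If; rewrite (ind _ Af If).
  exact: saturated0.
have [|gs [sgs Igs gsP]] := IH.
  by move=> i it; apply: alg; rewrite inE it orbT.
have algj : algebraic_mod I (tower (t ++ s)) (x j).
  by apply: algebraic_sub (alg j (mem_head _ _)) => a; apply: tower_cat.
have [g Ig gP] := divide_relation pI (tower_subring _) algj.
exists (g :: gs); split=> /=; first by rewrite sgs.
  by move=> k; rewrite inE => /predU1P[->//|/Igs].
move=> f Af If; have [h [a [r [nIh E rP]]]] := gP f Af If.
have [k nIk Gk] : saturated I gs r.[x j].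
  rewrite horner_coef; apply: big_ind; first exact: saturated0.
    by move=> y z; apply: saturatedD.
  move=> i _; rewrite mulrC; apply: saturatedM => //.
  by have [Ar Ir] := rP i; apply: gsP.
exists (k * h); first by case/(pidealP pI).
exists (k * a), (k * r.[x j]); split=> //.
by rewrite -mulrA E mulrDr mulrA.
Qed.

(** A new element that is not algebraic is transcendental, hence keeps the family
    independent; it is not in s, since elements of s are algebraic. *)
Lemma independent_cons I s j : prime_ideal I -> independent_mod I s ->
  ~ algebraic_mod I (tower s) (x j) ->
  independent_mod I (j :: s) /\ j \notin s.
Proof.
move=> pI ind nalg; split.
  move=> _ [q Aq ->] Iq; suff -> : q = 0 by rewrite horner0.
  apply/polyP => k; rewrite coef0; apply: ind; first exact: Aq.
  apply: NNPP => nIk.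
  by apply: nalg; exists q; split=> //; exists k.
apply/negP => js; apply: nalg; exists ('X - (x j)%:P); split.
- apply: poly_overB; [exact: tower_subring|apply: poly_overX|apply: poly_overC].
  + exact: tower_subring.
  + exact: tower_subring.
  exact: tower_gen.
- by rewrite !hornerE subrr; apply: pideal0.
by exists 1%N; rewrite coefB coefX coefC subr0; apply: pideal1 pI.
Qed.

(** Height and transcendence degree: if every x j were algebraic over the x s
    modulo the smaller ideal I, then an element f of the larger ideal I' that is
    not in I would have a multiple modulo I that is a nonzero element of the
    tower over s lying in I', contradicting independence modulo I'. *)
Lemma independent_grow (I I' : R -> Prop) s f :
  prime_ideal I -> prime_ideal I' -> (forall a, I a -> I' a) ->
  I' f -> ~ I f -> uniq s -> independent_mod I' s ->
  exists s', [/\ uniq s', size s' = (size s).+1 & independent_mod I s'].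
Proof.
move=> pI pI' II' I'f nIf us ind'.
have ind : independent_mod I s by move=> g Ag /II'; apply: ind'.
have [[j nalg]|alg] := classic (exists j, ~ algebraic_mod I (tower s) (x j)).
  have [indj js] := independent_cons pI ind nalg.
  by exists (j :: s); split=> //=; rewrite js.
have [||c [Ac nIc [a [b [Ib cE]]]]] := @eliminate_tower I (enum J) s f pI _ _ nIf.
- by move=> j _; apply: NNPP => nalg; apply: alg; exists j.
- by apply: tower_full => j; rewrite mem_cat mem_enum.
have c0 : c = 0.
  apply: ind' => //; rewrite cE; apply: pidealD => //; first exact: II'.
  exact: pidealM.
by case: nIc; rewrite c0; apply: pideal0.
Qed.

(** Enlarge s to a maximal independent family; all the other elements are then
    algebraic over it. *)
Lemma ideal_relations I s : prime_ideal I -> uniq s -> independent_mod I s ->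
  exists gs, [/\ (size gs + size s <= #|J|)%N, forall g, g \in gs -> I g &
    forall f, I f -> saturated I gs f].
Proof.
move=> pI; have [n] := ubnP (#|J| - size s); elim: n s => // n IH s.
rewrite ltnS => sn us ind.
have sJ : (size s <= #|J|)%N by rewrite -(card_uniqP us) max_card.
have [[j nalg]|alg] := classic (exists j, ~ algebraic_mod I (tower s) (x j)).
  have [indj js] := independent_cons pI ind nalg.
  have ujs : uniq (j :: s) by rewrite /= js.
  have ltJ : (size s < #|J|)%N.
    by have := max_card (mem (j :: s)); rewrite (card_uniqP ujs).
  have [||//|gs [sgs Igs gsP]] := IH (j :: s) => //.
    by rewrite (leq_trans _ sn) //= subnSK.
  by exists gs; split=> //; rewrite (leq_trans _ sgs) //= addnS.
pose t := [seq j <- enum J | j \notin s].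
have [|gs [sgs Igs gsP]] := @tower_relations I t s pI ind.
  by move=> j _; apply: NNPP => nalg; apply: alg; exists j.
exists gs; split=> //.
  have uts : uniq (t ++ s).
    rewrite cat_uniq filter_uniq ?enum_uniq // us andbT.
    by apply/hasPn => j js /=; rewrite mem_filter js.
  by rewrite sgs -size_cat -(card_uniqP uts) max_card.
move=> f; apply: gsP; apply: tower_full => j.
by rewrite mem_cat mem_filter mem_enum andbT orNb.
Qed.

End Tower.

(** * Directional derivatives and homogeneity *)

Section ProjectiveSets.

Variables (K : closedFieldType) (n : nat).

Implicit Types (p q : {mpoly K[n.+1]}) (x y v : 'rV[K]_n.+1) (X Z : projset K n).

Definition grad p x : 'rV[K]_n.+1 := \row_j (p^`M(j)).@[x 0].

Definition dderiv p x v := \sum_j (p^`M(j)).@[x 0] * v 0 j.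

Lemma meval_msum (J : Type) (r : seq J) (P : pred J)
    (F : J -> {mpoly K[n.+1]}) (w : 'I_n.+1 -> K) :
  (\sum_(j <- r | P j) F j).@[w] = \sum_(j <- r | P j) (F j).@[w].
Proof. exact: raddf_sum. Qed.

Lemma meval_mprod (J : Type) (r : seq J) (P : pred J)
    (F : J -> {mpoly K[n.+1]}) (w : 'I_n.+1 -> K) :
  (\prod_(j <- r | P j) F j).@[w] = \prod_(j <- r | P j) (F j).@[w].
Proof. exact: rmorph_prod. Qed.

(** The coordinates generate the polynomial ring over the constants, in the form
    in which the results on towers ask for it. *)
Lemma mpoly_subring (A : {mpoly K[n.+1]} -> Prop) : subring A ->
  (forall a, (exists c, a = c%:MP) -> A a) -> (forall j, A 'X_j) -> forall f, A f.
Proof.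
move=> sA AC AX f; rewrite [f]mpolyE; apply: subring_sum => // m.
rewrite -mul_mpolyC; apply: subringM => //; first by apply: AC; exists f@_m.
rewrite mpolyXE_id; apply: big_ind => //; first exact: subring1.
  by move=> a b; apply: subringM.
by move=> i _; apply: subringX.
Qed.

Lemma mpoly_alg_ind (P : {mpoly K[n.+1]} -> Prop) :
  (forall c, P c%:MP) -> (forall j, P 'X_j) ->
  (forall p q, P p -> P q -> P (p + q)) ->
  (forall p q, P p -> P q -> P (p * q)) -> forall p, P p.
Proof.
move=> PC PX PD PM; apply: mpoly_subring => // [|_ [c ->] //].
split=> //; first by rewrite -mpolyC1.
move=> p q Pp Pq; apply: PD => //; rewrite -mulN1r; apply: PM => //.
by rewrite -mpolyC1 -mpolyCN.
Qed.

Lemma dderivC c x v : dderiv c%:MP x v = 0.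
Proof. by apply: big1 => j _; rewrite mderivC meval0 mul0r. Qed.

Lemma dderivX i x v : dderiv 'X_i x v = v 0 i.
Proof.
rewrite /dderiv (bigD1 i) //= big1 ?addr0 => [|j ji].
  have -> : 'X_i^`M(i) = 1 :> {mpoly K[n.+1]}.
    rewrite mderivX mnm1E eqxx scale1r -(mpolyX0 _ K); congr 'X_[_].
    by apply/mnmP => k; rewrite mnmBE subnn mnm0E.
  by rewrite meval1 mul1r.
by rewrite mderivX mnm1E eq_sym (negbTE ji) scale0r meval0 mul0r.
Qed.

Lemma dderivD p q x v : dderiv (p + q) x v = dderiv p x v + dderiv q x v.
Proof.
by rewrite -big_split; apply: eq_bigr => j _; rewrite mderivD mevalD mulrDl.
Qed.

Lemma dderivM p q x v :
  dderiv (p * q) x v = dderiv p x v * q.@[x 0] + p.@[x 0] * dderiv q x v.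
Proof.
rewrite /dderiv mulr_suml mulr_sumr -big_split; apply: eq_bigr => j _ /=.
by rewrite mderivM mevalD !mevalM mulrDl mulrA [_ * q.@[_] * _]mulrAC.
Qed.

Lemma dderivB p q x v : dderiv (p - q) x v = dderiv p x v - dderiv q x v.
Proof.
by rewrite -sumrB; apply: eq_bigr => j _; rewrite mderivB mevalB mulrBl.
Qed.

Lemma dderiv_sum (J : Type) (r : seq J) (F : J -> {mpoly K[n.+1]}) x v :
  dderiv (\sum_(j <- r) F j) x v = \sum_(j <- r) dderiv (F j) x v.
Proof.
elim: r => [|j r IH]; first by rewrite !big_nil -mpolyC0 dderivC.
by rewrite !big_cons dderivD IH.
Qed.

Lemma dderivX_exp p k x v :
  dderiv (p ^+ k) x v = k%:R * p.@[x 0] ^+ k.-1 * dderiv p x v.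
Proof.
elim: k => [|k IH]; first by rewrite expr0 -mpolyC1 dderivC !mul0r.
rewrite exprS dderivM IH /= rmorphXn /=.
case: k {IH} => [|k] /=; first by rewrite mulr0n expr0; ring.
by rewrite exprS -[k.+2%:R]natr1; ring.
Qed.

Lemma dderivE p x v : v *m (grad p x)^T = (dderiv p x v)%:M.
Proof.
apply/matrixP => i j; rewrite !ord1 !mxE eqxx mulr1n.
by apply: eq_bigr => k _; rewrite !mxE mulrC.
Qed.

Lemma gradD p q x : grad (p + q) x = grad p x + grad q x.
Proof. by apply/rowP => j; rewrite !mxE mderivD mevalD. Qed.

Lemma gradM p q x : grad (p * q) x = q.@[x 0] *: grad p x + p.@[x 0] *: grad q x.
Proof.
by apply/rowP => j; rewrite !mxE mderivM mevalD !mevalM; congr (_ + _); rewrite mulrC.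
Qed.

Lemma homog_scale d p c x : p \is d.-homog -> p.@[(c *: x) 0] = c ^+ d * p.@[x 0].
Proof.
move=> /dhomogP hp; rewrite !mevalE mulr_sumr.
rewrite !big_seq; apply: eq_bigr => m /hp dm.
under eq_bigr do rewrite mxE exprMn.
by rewrite big_split /= prodrXr -mdegE dm mulrCA.
Qed.

End ProjectiveSets.

(** * Dimension is at most the rank of the tangent spaces *)

Section Cones.

Variables (K : closedFieldType) (n : nat).

Implicit Types (p q : {mpoly K[n.+1]}) (x y v : 'rV[K]_n.+1) (X Y Z : projset K n).

Definition ideal_of Z p := forall x, Z x -> p.@[x 0] = 0.

(** A root of q 'X + 1 is nonzero and is not a root of q. *)
Lemma closed_field_nonroot (q : {poly K}) : q != 0 ->
  exists2 t : K, t != 0 & q.[t] != 0.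
Proof.
move=> q0; have /closed_rootP[t] : size (q * 'X + 1) != 1%N.
  rewrite size_MXaddC (negbTE q0) /=.
  by rewrite eqSS size_poly_eq0.
rewrite /root !hornerE addr_eq0 => /eqP qt.
have : q.[t] * t != 0 by rewrite qt oppr_eq0 oner_eq0.
by rewrite mulf_eq0 negb_or => /andP[]; exists t.
Qed.

Lemma closed_scale Z x c : proj_closed Z -> c != 0 -> Z x -> Z (c *: x).
Proof.
case=> F homF ZP c0 /ZP[x0 Fx]; apply/ZP; split.
  by rewrite scaler_eq0 negb_or c0.
by move=> p Fp; have [d hp] := homF p Fp; rewrite (homog_scale _ _ hp) Fx ?mulr0.
Qed.

Lemma closed_nonzero Z x : proj_closed Z -> Z x -> x != 0.
Proof. by case=> F _ ZP /ZP[]. Qed.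

Lemma closed_form Z x : proj_closed Z -> x != 0 ->
  (forall p, vanishing_form Z p -> p.@[x 0] = 0) -> Z x.
Proof.
case=> F homF ZP x0 van; apply/ZP; split=> // p Fp; apply: van.
by split=> [|y /ZP[_]]; [exact: homF | apply].
Qed.

(** The restriction of p to the line spanned by x: its coefficients are the
    values at x of the homogeneous components of p. *)
Definition ray p x : {poly K} :=
  \poly_(d < msize p) (pihomog mdeg d p).@[x 0].

Lemma rayE p x t : (ray p x).[t] = p.@[(t *: x) 0].
Proof.
rewrite horner_poly [in RHS](pihomog_partitionE (mf := mdeg) (leqnn (msize p))).
rewrite meval_msum; apply: eq_bigr => d _.
by rewrite (homog_scale _ _ (pihomogP _ _ _)) mulrC.
Qed.

Lemma ray_eq0 p x : ray p x = 0 -> p.@[x 0] = 0.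
Proof. by move=> r0; rewrite -[x]scale1r -rayE r0 horner0. Qed.

Lemma ray_zeros_closed p : proj_closed (fun x => x != 0 /\ ray p x = 0).
Proof.
exists (fun q => exists d : nat, (d < msize p)%N /\ q = pihomog mdeg d p).
  by move=> _ [d [_ ->]]; exists d; apply: pihomogP.
move=> x; split=> [[x0 rx]|[x0 rx]]; split=> //.
  move=> _ [d [ld ->]].
  by have := congr1 (fun q : {poly K} => q`_d) rx; rewrite coef_poly ld coef0.
apply/polyP => d; rewrite coef_poly coef0; case: ltnP => // ld.
by apply: rx; exists d.
Qed.

(** Irreducibility is only assumed for sets of zeros of forms.  If p q vanishes on
    Z, then at each point of Z the product of the rays of p and q has infinitely
    many zeros, so one of the rays is 0.  The points where a given ray is 0 form
    a closed set, hence one of these two sets contains Z. *)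
Lemma ideal_of_prime Z : proj_variety Z -> prime_ideal (ideal_of Z).
Proof.
case=> cZ [z Zz] irr; split.
- by move=> x _; rewrite meval0.
- by move=> p q Ip Iq x Zx; rewrite mevalD Ip // Iq // addr0.
- by move=> p q Iq x Zx; rewrite mevalM Iq // mulr0.
- by move/(_ z Zz)/eqP; rewrite meval1 oner_eq0.
move=> p q Ipq.
case: (irr _ _ (ray_zeros_closed p) (ray_zeros_closed q)).
- move=> x Zx; have x0 := closed_nonzero cZ Zx.
  have : ray p x * ray q x = 0.
    apply/eqP; apply: contraT => /closed_field_nonroot[t t0].
    by rewrite hornerM !rayE -mevalM Ipq ?eqxx //; apply: closed_scale.
  by move/eqP; rewrite mulf_eq0 => /orP[]/eqP rx; [left|right].
- by move=> sub; left => x /sub[_ /ray_eq0].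
by move=> sub; right => x /sub[_ /ray_eq0].
Qed.

Lemma coordinate_free (I : {mpoly K[n.+1]} -> Prop) : prime_ideal I ->
  independent_mod (fun f => exists c, f = c%:MP) (fun j : 'I_n.+1 => 'X_j) I [::].
Proof.
move=> pI _ /= [c ->] Ic; have [->//|c0] := eqVneq c 0.
case: (pideal1 pI); rewrite -mpolyC1 -(mulVf c0) mpolyCM; exact: pidealM.
Qed.

Lemma constants_subring : subring (fun f : {mpoly K[n.+1]} => exists c, f = c%:MP).
Proof.
split; first by exists 1.
  by move=> _ _ [a ->] [b ->]; exists (a - b); rewrite mpolyCB.
by move=> _ _ [a ->] [b ->]; exists (a * b); rewrite mpolyCM.
Qed.

(** The prime ideal of the vertex of the affine cones: it lies above the ideals
    of all projective varieties, so a chain of length e gives e + 2 primes. *)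
Definition origin_ideal p := p.@[(0 : 'rV[K]_n.+1) 0] = 0.

Lemma origin_ideal_prime : prime_ideal origin_ideal.
Proof.
rewrite /origin_ideal; split; first exact: meval0.
- by move=> p q; rewrite mevalD => -> ->; rewrite addr0.
- by move=> p q; rewrite mevalM => ->; rewrite mulr0.
- by rewrite meval1; apply/eqP/oner_neq0.
by move=> p q /eqP; rewrite mevalM mulf_eq0 => /orP[]/eqP; [left|right].
Qed.

Lemma ray_const_coef p x : (ray p x).[0] = p.@[(0 : 'rV[K]_n.+1) 0].
Proof. by rewrite rayE scale0r. Qed.

Lemma ideal_of_origin Z p : proj_variety Z -> ideal_of Z p -> origin_ideal p.
Proof.
case=> cZ [z Zz] _ Ip; rewrite /origin_ideal -(ray_const_coef p z).
suff -> : ray p z = 0 by rewrite horner0.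
apply/eqP; apply: contraT => /closed_field_nonroot[t t0].
by rewrite rayE Ip ?eqxx //; apply: closed_scale.
Qed.

Notation indep I s := (independent_mod (fun f : {mpoly K[n.+1]} => exists c, f = c%:MP)
  (fun j : 'I_n.+1 => 'X_j) I s).

Lemma chain_independent (Z : nat -> projset K n) e :
  (forall i, (i <= e)%N -> proj_variety (Z i)) ->
  (forall i, (i < e)%N -> psubset (Z i) (Z i.+1)) ->
  exists s, [/\ uniq s, size s = e.+1 & indep (ideal_of (Z e)) s].
Proof.
elim: e => [|e IH] vZ sZ.
  have vZ0 := vZ 0%N isT; have [cZ [z Zz] _] := vZ0.
  have [j zj] : exists j, z 0 j != 0.
    have := closed_nonzero cZ Zz; case: (pickP (fun j => z 0 j != 0)) => [j ? _|z0].
      by exists j.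
    by case/eqP; apply/rowP => j; rewrite mxE; apply/eqP; have:= z0 j => /negbFE.
  apply: (@independent_grow _ _ _ _ constants_subring (@mpoly_subring _ _)
    (ideal_of (Z 0%N)) origin_ideal [::] 'X_j) => //.
  - exact: ideal_of_prime.
  - exact: origin_ideal_prime.
  - by move=> p; apply: ideal_of_origin.
  - by rewrite /origin_ideal mevalXU mxE.
  - by move/(_ z Zz)/eqP; rewrite mevalXU; apply/negP.
  exact: coordinate_free origin_ideal_prime.
have [||s [us ss inds]] := IH; [by move=> i /leqW; apply: vZ| |].
  by move=> i ie; apply: sZ; apply: leqW.
have [sub nsub] := sZ e (leqnn _).
have [cZ _ _] := vZ e (leqW (leqnn _)); have vZ' := vZ e.+1 (leqnn _).
have [cZ' _ _] := vZ'.
have [p [Ip nIp]] : exists p, ideal_of (Z e) p /\ ~ ideal_of (Z e.+1) p.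
  apply: NNPP => no; apply: nsub => x Zx; apply: closed_form => //.
    exact: closed_nonzero Zx.
  move=> p [_ vp]; apply: NNPP => px; apply: no; exists p; split=> //.
  by move/(_ x Zx).
suff : exists s', [/\ uniq s', size s' = (size s).+1 & indep (ideal_of (Z e.+1)) s'].
  by rewrite ss.
apply: (@independent_grow _ _ _ _ constants_subring (@mpoly_subring _ _)
    (ideal_of (Z e.+1)) (ideal_of (Z e)) s p) => //.
- exact: ideal_of_prime.
- by apply: ideal_of_prime; apply: vZ; apply: leqW.
by move=> f If x /sub; apply: If.
Qed.

Lemma generated_grad gs z Z y k (A : 'M[K]_(k, n.+1)) :
  (forall g, g \in gs -> ideal_of Z g) -> Z y ->
  (forall g, g \in gs -> (grad g y <= A)%MS) -> generated gs z ->
  z.@[y 0] = 0 /\ (grad z y <= A)%MS.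
Proof.
move=> + Zy; elim: gs z => [|g gs IH] z /= Igs Ags.
  move=> ->; rewrite meval0; split=> //.
  rewrite (_ : grad 0 y = 0) ?sub0mx //.
  by apply/rowP => j; rewrite !mxE mderiv0 meval0.
case=> a [b [Gb ->]].
have [||b0 Ab] := IH b _ _ Gb.
- by move=> h hgs; apply: Igs; rewrite inE hgs orbT.
- by move=> h hgs; apply: Ags; rewrite inE hgs orbT.
have g0 : g.@[y 0] = 0 by apply: Igs; rewrite ?mem_head.
rewrite mevalD mevalM g0 b0 mulr0 addr0; split=> //.
rewrite gradD gradM g0 scale0r add0r addmx_sub // scalemx_sub //.
by apply: Ags; rewrite mem_head.
Qed.

Definition jacobian (fs : seq {mpoly K[n.+1]}) y : 'M[K]_(size fs, n.+1) :=
  \matrix_(i < size fs) grad fs`_i y.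

Lemma grad_jacobian fs f y : f \in fs -> (grad f y <= jacobian fs y)%MS.
Proof.
move=> ffs; have ltf : (index f fs < size fs)%N by rewrite index_mem.
by have := row_sub (Ordinal ltf) (jacobian fs y); rewrite rowK nth_index.
Qed.

Lemma common_saturation I gs (fs : seq {mpoly K[n.+1]}) : prime_ideal I ->
  (forall f, f \in fs -> saturated I gs f) ->
  exists2 h, ~ I h & forall f, f \in fs -> generated gs (h * f).
Proof.
move=> pI; elim: fs => [|f fs IH] sat.
  by exists 1 => //; apply: pideal1 pI.
have [|h nIh hP] := IH; first by move=> g gfs; apply: sat; rewrite inE gfs orbT.
have [k nIk kP] := sat f (mem_head _ _).
exists (h * k); first by case/(pidealP pI).
move=> g; rewrite inE => /predU1P[->|/hP Gg].
  by rewrite -mulrA; apply: generatedM.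
by rewrite [h * k]mulrC -mulrA; apply: generatedM.
Qed.

(** Constant matrices P and B reduce the Jacobian matrix at y0 to an identity
    matrix of size its rank; D is the determinant of P J B for the Jacobian
    matrix J at a variable point. *)
Lemma jacobian_open fs y0 : exists2 D : {mpoly K[n.+1]}, D.@[y0 0] != 0 &
  forall y, D.@[y 0] != 0 -> (\rank (jacobian fs y0) <= \rank (jacobian fs y))%N.
Proof.
set G := jacobian fs y0.
have /row_fullP[P PG] := col_base_full G.
have /row_freeP[B GB] := row_base_free G.
pose S : 'M[{mpoly K[n.+1]}]_(size fs, n.+1) := \matrix_(i, j) fs`_i^`M(j).
pose D := \det (map_mx (@mpolyC n.+1 K) P *m S *m map_mx (@mpolyC n.+1 K) B).
have DE y : D.@[y 0] = \det (P *m jacobian fs y *m B).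
  rewrite /D -[LHS]/((meval (y 0)) _) -det_map_mx !map_mxM -!map_mx_comp.
  congr (\det (_ *m _ *m _)).
  - by apply/matrixP => i j; rewrite !mxE /= mevalC.
  - by apply/matrixP => i j; rewrite !mxE.
  by apply/matrixP => i j; rewrite !mxE /= mevalC.
exists D => [|y].
  have PGB : P *m G *m B = 1%:M.
    rewrite -[X in P *m X *m _](mulmx_base G).
    by rewrite mulmxA PG mul1mx GB.
  by rewrite DE PGB det1 oner_neq0.
rewrite DE -unitfE -unitmxE => /mxrank_unit rG.
rewrite -[X in (X <= _)%N]rG.
by rewrite (leq_trans (mxrankM_maxl _ _)) // mxrankM_maxr.
Qed.

Lemma exists_max_nat (P : nat -> Prop) k N : P k -> (forall i, P i -> (i <= N)%N) ->
  exists2 m, P m & forall i, P i -> (i <= m)%N.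
Proof.
move=> + PN; have [d] := ubnP (N - k); elim: d k => // d IH k.
rewrite ltnS => kd Pk.
have [[i [Pi lti]]|no] := classic (exists i, P i /\ (k < i)%N).
  have ltN : (k < N)%N := leq_trans lti (PN _ Pi).
  by apply: IH Pi; apply: leq_trans kd; apply: ltn_sub2l.
by exists k => // i Pi; rewrite leqNgt; apply/negP => lti; apply: no; exists i.
Qed.

(** Finitely many vanishing forms cut out the tangent space: take a list whose
    Jacobian matrix at x0 has the largest possible rank. *)
Lemma tangent_jacobian X x0 : exists fs, (forall f, f \in fs -> vanishing_form X f) /\
  forall v, tangent X x0 v <-> v *m (jacobian fs x0)^T = 0.
Proof.
pose P k := exists fs, (forall f, f \in fs -> vanishing_form X f) /\
  \rank (jacobian fs x0) = k.
have P0 : P (\rank (jacobian [::] x0)) by exists [::].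
have [|m [fs [Vfs rfs]] mmax] := @exists_max_nat P _ n.+1 P0.
  by move=> _ [fs [_ <-]]; apply: rank_leq_col.
exists fs; split=> // v; split=> [tv|Jv p Vp].
  apply/matrixP => i j; rewrite ord1 !mxE.
  have /Vfs/tv : fs`_j \in fs by rewrite mem_nth.
  by move=> E; rewrite -[RHS]E; apply: eq_bigr => k _; rewrite !mxE mulrC.
suff /submxP[D pD] : (grad p x0 <= jacobian fs x0)%MS.
  have := dderivE p x0 v; rewrite -/(dderiv p x0 v) pD trmx_mul mulmxA Jv mul0mx.
  by move/matrixP/(_ 0 0); rewrite !mxE eqxx mulr1n => <-.
have sub : (jacobian fs x0 <= jacobian (p :: fs) x0)%MS.
  apply/row_subP => i; rewrite rowK; apply: grad_jacobian.
  by rewrite inE mem_nth ?orbT.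
have : \rank (jacobian fs x0) == \rank (jacobian (p :: fs) x0).
  rewrite eqn_leq mxrankS //= rfs; apply: mmax; exists (p :: fs); split=> //.
  by move=> f; rewrite inE => /predU1P[->//|]; apply: Vfs.
rewrite (mxrank_leqif_sup sub); apply: submx_trans.
by apply: grad_jacobian; rewrite mem_head.
Qed.

(** Compare two bounds at a general point y of the top member Z e of the chain.
    Forms fs that cut out the tangent space of X at some point of Z e have a
    Jacobian matrix at y of at least the same rank.  Since they lie in the ideal
    of Z e, up to nonzero factors their gradients at y are combinations of the
    gradients of the relations of [ideal_relations], and there are few of
    these. *)
Lemma chain_lt_tangent X e r : has_chain X e ->
  (forall x, X x -> exists2 T : 'M[K]_n.+1, \rank T = r &
     forall v : 'rV[K]_n.+1, (v <= T)%MS <-> tangent X x v) ->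
  (e < r)%N.
Proof.
case=> Z [vZ sZ ZX] tanX.
have vZe := vZ e (leqnn _); have [cZ [y0 Zy0] _] := vZe.
have pI := ideal_of_prime vZe.
have [s [us ss inds]] := chain_independent vZ sZ.
have [gs [sgs Igs gsP]] :=
  ideal_relations constants_subring (@mpoly_subring _ _) pI us inds.
have [T rT TP] := tanX y0 (ZX _ Zy0).
have [fs [Vfs fsP]] := tangent_jacobian X y0.
have Ifs f : f \in fs -> ideal_of (Z e) f.
  by move=> /Vfs[_ vf] x /ZX; apply: vf.
have [h nIh hP] := common_saturation pI (fun f ffs => gsP f (Ifs f ffs)).
have [D D0 DP] := jacobian_open fs y0.
(* General means: outside the zeros of the minor D and of the factor h. *)
have [y [Zy /eqP]] : exists y, Z e y /\ (D * h).@[y 0] <> 0.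
  apply: NNPP => no; have : ideal_of (Z e) (D * h).
    by move=> y Zy; apply: NNPP => Dh; apply: no; exists y.
  case/(pidealP pI) => // ID; move: D0; rewrite ID ?eqxx //.
rewrite mevalM mulf_eq0 negb_or => /andP[Dy hy].
have leJ : (\rank (jacobian fs y0) <= size gs)%N.
  apply: leq_trans (DP _ Dy) _; apply: leq_trans (rank_leq_row (jacobian gs y)).
  apply: mxrankS; apply/row_subP => i; rewrite rowK.
  have fi : fs`_i \in fs by rewrite mem_nth.
  have [_] := generated_grad Igs Zy (fun g ggs => grad_jacobian y ggs) (hP _ fi).
  rewrite gradM (Ifs _ fi) // scale0r add0r => /(scalemx_sub h.@[y 0]^-1).
  by rewrite scalerA mulVf // scale1r.
have -> : r = (n.+1 - \rank (jacobian fs y0))%N.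
  rewrite -rT -(mxrank_tr (jacobian _ _)) -mxrank_ker.
  apply: eqmx_rank; apply/andP; split; apply/rV_subP => v.
    by move=> /TP/fsP/eqP; rewrite -sub_kermx.
  by rewrite sub_kermx => /eqP/fsP/TP.
rewrite card_ord ss in sgs.
by rewrite ltn_subRL -addnS (leq_trans _ sgs) // leq_add2r.
Qed.

End Cones.

(** * Linear forms and linear substitutions *)

Section LinearForms.

Variables (K : closedFieldType) (n : nat).

Implicit Types (p q : {mpoly K[n.+1]}) (x y v : 'rV[K]_n.+1) (X Z : projset K n).

Definition functional y (c : 'cV[K]_n.+1) : K := (y *m c) 0 0.

Lemma functionalE y c : functional y c = \sum_j y 0 j * c j 0.
Proof. by rewrite /functional mxE. Qed.

Lemma functionalD x y c : functional (x + y) c = functional x c + functional y c.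
Proof. by rewrite /functional mulmxDl mxE. Qed.

Lemma functionalZ a y c : functional (a *: y) c = a * functional y c.
Proof. by rewrite /functional -scalemxAl mxE. Qed.

Lemma functional_col y m (L : 'M[K]_(n.+1, m)) j : functional y (col j L) = (y *m L) 0 j.
Proof. by rewrite functionalE mxE; apply: eq_bigr => i _; rewrite mxE. Qed.

Definition linear_form (c : 'cV[K]_n.+1) : {mpoly K[n.+1]} := \sum_j c j 0 *: 'X_j.

Lemma linear_form_eval c y : (linear_form c).@[y 0] = functional y c.
Proof.
rewrite functionalE meval_msum; apply: eq_bigr => j _.
by rewrite mevalZ mevalXU mulrC.
Qed.

Lemma linear_form_homog c : linear_form c \is 1.-homog.
Proof. by apply: rpred_sum => j _; apply: rpredZ; rewrite dhomogX /= mdeg1. Qed.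

Lemma linear_form_deriv c y v : dderiv (linear_form c) y v = functional v c.
Proof.
rewrite functionalE dderiv_sum; apply: eq_bigr => j _.
by rewrite -mul_mpolyC dderivM dderivC mul0r add0r mevalC dderivX mulrC.
Qed.

Lemma homog_bigprod (J : Type) (r : seq J) (d : J -> nat) (F : J -> {mpoly K[n.+1]}) :
  (forall j, F j \is (d j).-homog) ->
  \prod_(j <- r) F j \is (\sum_(j <- r) d j).-homog.
Proof.
move=> hF; elim: r => [|j r IH]; first by rewrite !big_nil dhomog1.
by rewrite !big_cons dhomogM.
Qed.

Definition substitute (L : 'M[K]_n.+1) p : {mpoly K[n.+1]} :=
  p \mPo [tuple linear_form (col j L) | j < n.+1].

Lemma substitute_eval L p y : (substitute L p).@[y 0] = p.@[(y *m L) 0].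
Proof.
rewrite comp_mpoly_meval; apply: meval_eq => j.
by rewrite tnth_mktuple linear_form_eval functional_col.
Qed.

Lemma substitute_homog L p d : p \is d.-homog -> substitute L p \is d.-homog.
Proof.
move=> /dhomogP hp; rewrite /substitute comp_mpolyE big_seq.
apply: rpred_sum => m /hp dm; apply: rpredZ.
rewrite -dm /= mdegE; apply: homog_bigprod => i.
rewrite tnth_mktuple.
by have := dhomogMn (m i) (linear_form_homog (col i L)); rewrite mul1n.
Qed.

Lemma substitute_deriv L p y v :
  dderiv (substitute L p) y v = dderiv p (y *m L) (v *m L).
Proof.
have sM p1 p2 : substitute L (p1 * p2) = substitute L p1 * substitute L p2.
  exact: rmorphM.
elim/mpoly_alg_ind: p => [c|j|p q IHp IHq|p q IHp IHq].
- by rewrite /substitute comp_mpolyC !dderivC.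
- rewrite /substitute comp_mpolyXU -tnth_nth tnth_mktuple linear_form_deriv.
  by rewrite dderivX functional_col.
- by rewrite /substitute comp_mpolyD !dderivD -/(substitute L p) IHp -/(substitute L q) IHq.
by rewrite sM !dderivM IHp IHq !substitute_eval.
Qed.

(** The linear forms that vanish on the span of X vanish on X. *)
Lemma tangent_span X m (A : 'M[K]_(m, n.+1)) x v :
  (forall z, X z -> (z <= A)%MS) -> tangent X x v -> (v <= A)%MS.
Proof.
move=> XA tv; rewrite submxE; apply/eqP/rowP => j; rewrite [RHS]mxE -functional_col.
rewrite -(linear_form_deriv _ x); apply: tv; split.
  by exists 1%N; apply: linear_form_homog.
by move=> z /XA; rewrite submxE => /eqP zA; rewrite linear_form_eval functional_col zA mxE.
Qed.

(** The partial derivatives of a form are again forms. *)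
Lemma tangent_scale X x c v : c != 0 -> tangent X (c *: x) v -> tangent X x v.
Proof.
move=> c0 tv p [[d hp] vp].
have hderiv j : (p^`M(j)).@[(c *: x) 0] = c ^+ d.-1 * (p^`M(j)).@[x 0].
  apply: homog_scale; apply/dhomogP => m.
  rewrite mcoeff_msupp mcoeff_deriv => pm.
  have := dhomogP _ _ _ hp (m + U_(j))%MM; rewrite mcoeff_msupp /= mdegD mdeg1 addn1.
  by move=> <- //; apply: contraNneq pm => ->; rewrite mul0rn.
have /eqP := tv p (conj (ex_intro _ d hp) vp).
under eq_bigr do rewrite hderiv -mulrA.
by rewrite -mulr_sumr mulf_eq0 expf_eq0 (negbTE c0) andbF => /eqP.
Qed.

Lemma dderiv_prod (J : finType) (F : J -> {mpoly K[n.+1]}) x v :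
  dderiv (\prod_i F i) x v =
  \sum_i dderiv (F i) x v * \prod_(j | j != i) (F j).@[x 0].
Proof.
elim: (index_enum J) (index_enum_uniq J) => [|a r IH] /=.
  by rewrite !big_nil -mpolyC1 dderivC.
case/andP=> ar ur; rewrite !big_cons dderivM IH // eqxx /= meval_mprod.
congr (_ * _ + _).
  rewrite big_seq [RHS]big_seq_cond; apply: eq_bigl => j.
  by case: (boolP (j \in r)) => //= jr; apply/esym; apply: contraNneq ar => <-.
rewrite mulr_sumr !big_seq; apply: eq_bigr => i ir; rewrite big_cons.
by case: eqVneq ir ar => [->->//|_ _ _]; rewrite mulrCA.
Qed.

Lemma euler p d x : p \is d.-homog -> dderiv p x x = d%:R * p.@[x 0].
Proof.
move=> hp; rewrite {1}(mpolyE p) dderiv_sum mevalE mulr_sumr !big_seq.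
apply: eq_bigr => m pm.
rewrite -mul_mpolyC dderivM dderivC mul0r add0r mevalC mulrCA; congr (_ * _).
rewrite -(dhomogP _ _ _ hp m pm) /= mdegE natr_sum mulr_suml mpolyXE_id dderiv_prod.
apply: eq_bigr => i _; rewrite dderivX_exp dderivX mevalXU.
rewrite [in RHS](bigD1 i) //= mulrA; congr (_ * _); last first.
  by apply: eq_bigr => j _; rewrite rmorphXn /= mevalXU.
by case: (m i) => [|k]; rewrite ?mul0r // -mulrA -exprSr.
Qed.

Lemma euler_tangent X x : X x -> tangent X x x.
Proof.
by move=> Xx p [[d hp] vp]; rewrite -/(dderiv p x x) (euler _ hp) vp ?mulr0.
Qed.

End LinearForms.

(** * Products whose factors can be recovered linearly *)

Section Factors.

Variables (K : closedFieldType) (n l : nat).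
Hypothesis l_gt0 : (0 < l)%N.

Local Notation point := ('I_l -> 'rV[K]_n.+1).

Implicit Types (x : point) (X Z : 'I_l -> projset K n).

Definition subst_at x i z : point := fun i' => if i' == i then z else x i'.

(** The linear map that sends z to the product of z with all the factors of x but
    the i-th. *)
Definition slot x i : 'M[K]_n.+1 := diag_mx (\row_j \prod_(i' | i' != i) x i' 0 j).

Lemma hadamard_subst x i z : hadamard_point (subst_at x i z) = z *m slot x i.
Proof.
apply/rowP => j; rewrite mul_mx_diag !mxE (bigD1 i) //= /subst_at eqxx.
by congr (_ * _); apply: eq_bigr => i' /negbTE->.
Qed.

Lemma hadamard_slot x i : hadamard_point x = x i *m slot x i.
Proof. by apply/rowP => j; rewrite mul_mx_diag !mxE (bigD1 i). Qed.

Variables (m : 'I_l -> nat) (A : forall i, 'M[K]_(m i, n.+1)).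
Variables (J : Type) (lam : J -> 'I_l -> 'cV[K]_n.+1) (beta : J -> 'cV[K]_n.+1).
Variables (S : J -> 'I_l -> 'M[K]_n.+1) (P : 'M[K]_n.+1).

Definition in_spans x := forall i, (x i <= A i)%MS.

Definition cofactor_at k x i := \prod_(i' | i' != i) functional (x i') (lam k i').

(** What is used of the Segre embedding.  An index k stands for the choice of one
    coordinate [lam k i] on each span; [beta k] is the corresponding coordinate of
    tensors, and [S k i] restricts a tensor to the line through k in direction i,
    read as a vector of the i-th span.  On a decomposable tensor it gives the i-th
    factor times the chosen coordinates of the others.  All the products lie in
    the kernel of P, on which the coordinates [beta k] determine the vector. *)
Record recovers_factors : Prop := RecoversFactors {
  rf_coord : forall k x, in_spans x ->
    functional (hadamard_point x) (beta k) = \prod_i functional (x i) (lam k i);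
  rf_slice : forall k i x, in_spans x ->
    hadamard_point x *m S k i = cofactor_at k x i *: x i;
  rf_separate : forall x, in_spans x -> (forall i, x i != 0) ->
    exists k, forall i, functional (x i) (lam k i) != 0;
  rf_span : forall x, in_spans x -> hadamard_point x *m P = 0;
  rf_nonzero : forall y, y != 0 -> y *m P = 0 -> exists k, functional y (beta k) != 0 }.

Hypothesis rf : recovers_factors.

Lemma hadamard_neq0 x : in_spans x -> (forall i, x i != 0) -> hadamard_point x != 0.
Proof.
move=> Ax x0; have [k kx] := rf_separate rf Ax x0.
apply: contraTneq isT => H0; have := rf_coord rf k Ax.
rewrite H0 /functional mul0mx mxE => /esym/eqP; rewrite prodf_seq_eq0.
by case/hasP => i _ /=; rewrite (negbTE (kx i)).
Qed.

(** The slices recover each factor up to a scalar. *)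
Lemma hadamard_inj x x' : in_spans x -> in_spans x' -> (forall i, x i != 0) ->
  hadamard_point x = hadamard_point x' ->
  forall i, exists2 c, c != 0 & x i = c *: x' i.
Proof.
move=> Ax Ax' x0 E i; have [k kx] := rf_separate rf Ax x0.
have := rf_slice rf k i Ax; rewrite E (rf_slice rf) // => {}E.
have c0 : cofactor_at k x i != 0 by apply/prodf_neq0 => i' _; apply: kx.
exists ((cofactor_at k x i)^-1 * cofactor_at k x' i).
  rewrite mulf_neq0 ?invr_neq0 //; apply: contraNneq (x0 i) => c0'.
  move: E; rewrite c0' scale0r => /esym/eqP; rewrite scaler_eq0 (negbTE c0) /=.
  by [].
by rewrite -scalerA E scalerA mulVf // scale1r.
Qed.

Section Product.

Variable X : 'I_l -> projset K n.
Hypotheses (cX : forall i, proj_closed (X i)) (XA : forall i z, X i z -> (z <= A i)%MS).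

Lemma in_spansP x : (forall i, X i (x i)) -> in_spans x.
Proof. by move=> Xx i; apply: XA. Qed.

Lemma hadamard_image_point x : (forall i, X i (x i)) -> hadamard_image X (hadamard_point x).
Proof.
move=> Xx; split; last by exists x.
by apply: hadamard_neq0; [exact: in_spansP | move=> i; apply: closed_nonzero (Xx i)].
Qed.

Lemma subst_atP (Q : 'I_l -> 'rV[K]_n.+1 -> Prop) x i z :
  (forall i', Q i' (x i')) -> Q i z -> forall i', Q i' (subst_at x i z i').
Proof. by move=> Qx Qz i'; rewrite /subst_at; case: eqP => // ->. Qed.

(** If [beta k] does not vanish at y, these forms say that y is, up to a scalar,
    the product of its own slices. *)
Definition rank_one_form k j : {mpoly K[n.+1]} :=
  linear_form (beta k) ^+ l.-1 * 'X_j - \prod_i linear_form (col j (S k i)).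

Lemma rank_one_form_homog k j : rank_one_form k j \is l.-homog.
Proof.
apply: rpredB.
  have hb := dhomogMn l.-1 (linear_form_homog (beta k)).
  have hX : ('X_j : {mpoly K[n.+1]}) \is 1.-homog by rewrite dhomogX /= mdeg1.
  by have := dhomogM hb hX; rewrite mul1n addn1 prednK.
have := homog_bigprod (index_enum 'I_l) (d := fun=> 1%N)
  (fun i => linear_form_homog (col j (S k i))).
by rewrite sum1_size /index_enum -enumT size_enum_ord.
Qed.

Lemma rank_one_form_eval k j (y : 'rV[K]_n.+1) : (rank_one_form k j).@[y 0] =
  functional y (beta k) ^+ l.-1 * y 0 j - \prod_i (y *m S k i) 0 j.
Proof.
rewrite mevalB mevalM rmorphXn /= linear_form_eval mevalXU meval_mprod.
by congr (_ - _); apply: eq_bigr => i _; rewrite linear_form_eval functional_col.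
Qed.

Lemma prod_cofactor k x : \prod_i cofactor_at k x i =
  (\prod_i functional (x i) (lam k i)) ^+ l.-1.
Proof.
rewrite /cofactor_at (exchange_big_dep predT) //= -prodrXl.
apply: eq_bigr => i _; under eq_bigl do rewrite eq_sym.
by rewrite prodr_const cardC1 card_ord.
Qed.

Lemma rank_one_form_vanish k j x : in_spans x -> (rank_one_form k j).@[hadamard_point x 0] = 0.
Proof.
move=> Ax; rewrite rank_one_form_eval (rf_coord rf) // -prod_cofactor mxE -big_split.
apply/eqP; rewrite subr_eq0; apply/eqP; apply: eq_bigr => i _.
by rewrite (rf_slice rf) // [in RHS]mxE.
Qed.

Lemma slice_form_vanish k i x q : vanishing_form (X i) q -> (forall i, X i (x i)) ->
  (substitute (S k i) q).@[hadamard_point x 0] = 0.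
Proof.
move=> [[d hq] vq] Xx; rewrite substitute_eval (rf_slice rf); last exact: in_spansP.
by rewrite (homog_scale _ _ hq) vq ?mulr0.
Qed.

Definition product_form p :=
  [\/ exists j, p = linear_form (col j P),
      exists k j, p = rank_one_form k j |
      exists k i q, vanishing_form (X i) q /\ p = substitute (S k i) q].

(** The equations are: those of the span of all the products, the rank one
    forms, and those of the X i applied to the slices.  Conversely, a nonzero
    solution y has a nonzero [beta k], so y is proportional to the product of
    its slices, which are points of the X i; the scalar is absorbed in one of the
    factors. *)
Lemma hadamard_image_closed : proj_closed (hadamard_image X).
Proof.
exists product_form.
  move=> _ [[j ->]|[k [j ->]]|[k [i [q [[[d hq] _] ->]]]]].
  - by exists 1%N; apply: linear_form_homog.
  - by exists l; apply: rank_one_form_homog.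
  by exists d; apply: substitute_homog.
move=> y; split=> [[y0 [x Xx ->]]|[y0 Fy]].
  split; first by have [] := hadamard_image_point Xx.
  move=> _ [[j ->]|[k [j ->]]|[k [i [q [vq ->]]]]].
  - by rewrite linear_form_eval functional_col (rf_span rf) ?mxE //; apply: in_spansP.
  - exact/rank_one_form_vanish/in_spansP.
  exact: slice_form_vanish.
split=> //.
have yP : y *m P = 0.
  apply/rowP => j; rewrite -functional_col -linear_form_eval mxE.
  by apply: Fy; constructor 1; exists j.
have [k bk] := rf_nonzero rf y0 yP.
pose b := functional y (beta k); pose x i := y *m S k i.
have E : hadamard_point x = b ^+ l.-1 *: y.
  apply/rowP => j; rewrite !mxE; apply/esym/eqP; rewrite -subr_eq0.
  by rewrite -rank_one_form_eval Fy //; constructor 2; exists k, j.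
have bl : b ^+ l.-1 != 0 by rewrite expf_neq0.
have Xx i : X i (x i).
  apply: closed_form => //.
    apply: contraNneq y0 => xi0; move: E; rewrite (hadamard_slot _ i) xi0 mul0mx.
    by move/esym/eqP; rewrite scaler_eq0 (negbTE bl).
  move=> q vq; rewrite -substitute_eval; apply: Fy.
  by constructor 3; exists k, i, q.
pose i0 : 'I_l := Ordinal l_gt0.
exists (subst_at x i0 ((b ^+ l.-1)^-1 *: x i0)).
  by apply: subst_atP => //; apply: closed_scale; rewrite ?invr_neq0.
by rewrite hadamard_subst -scalemxAl -hadamard_slot E scalerA mulVf // scale1r.
Qed.

(** With all the factors but one fixed, the product depends linearly on the
    remaining factor. *)
Lemma slot_preimage_closed (V : projset K n) x i : proj_closed V ->
  proj_closed (fun z => z != 0 /\ forall p, vanishing_form V p ->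
    p.@[(z *m slot x i) 0] = 0).
Proof.
move=> cV; exists (fun q => exists p, vanishing_form V p /\ q = substitute (slot x i) p).
  by move=> _ [p [[[d hp] _] ->]]; exists d; apply: substitute_homog.
move=> z; split=> [[z0 Vz]|[z0 Vz]]; split=> //.
  by move=> _ [p [vp ->]]; rewrite substitute_eval; apply: Vz.
by move=> p vp; rewrite -substitute_eval; apply: Vz; exists p.
Qed.

(** Suppose that the products of x and of y avoid the closed sets V and W,
    respectively.  The values of one factor for which they still do are nonempty
    open subsets of the irreducible X i, so they have a common point.  Changing
    the factors of x and y to such a common value one after the other ends with a
    single point outside both V and W. *)
Lemma hadamard_image_variety : (forall i, proj_variety (X i)) ->
  proj_variety (hadamard_image X).
Proof.
move=> vX; split; first exact: hadamard_image_closed.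
  have [x Xx] : exists x : point, forall i, X i (x i).
    have /fin_all_exists[x Xx] : forall i : 'I_l, exists z, X i z.
      by move=> i; have [_ ? _] := vX i.
    by exists x.
  by exists (hadamard_point x); apply: hadamard_image_point.
move=> V W cV cW YVW; apply: NNPP => no.
have [x [Xx nVx]] : exists x, (forall i, X i (x i)) /\ ~ V (hadamard_point x).
  apply: NNPP => nox; apply: no; left=> _ [_ [x Xx ->]].
  by apply: NNPP => nV; apply: nox; exists x.
have [y [Xy nWy]] : exists y, (forall i, X i (y i)) /\ ~ W (hadamard_point y).
  apply: NNPP => noy; apply: no; right=> _ [_ [y Xy ->]].
  by apply: NNPP => nW; apply: noy; exists y.
have step k : (k <= l)%N -> exists x y, [/\ forall i, X i (x i), forall i, X i (y i),
    ~ V (hadamard_point x), ~ W (hadamard_point y) &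
    forall i : 'I_l, (i < k)%N -> x i = y i].
  elim: k => [_|k IH kl]; first by exists x, y.
  have [x1 [y1 [Xx1 Xy1 nV nW E]]] := IH (ltnW kl).
  pose i := Ordinal kl; have [cXi _ irr] := vX i.
  have cV' := slot_preimage_closed x1 i cV; have cW' := slot_preimage_closed y1 i cW.
  have [z [Xz nVz nWz]] : exists z, [/\ X i z,
      ~ V (hadamard_point (subst_at x1 i z)) & ~ W (hadamard_point (subst_at y1 i z))].
    apply: NNPP => noz.
    have inV (U : projset K n) (w : point) z : (forall i, X i (w i)) -> X i z ->
        U (hadamard_point (subst_at w i z)) -> z != 0 /\
        forall p, vanishing_form U p -> p.@[(z *m slot w i) 0] = 0.
      move=> Xw Xz Uz; split; first exact: closed_nonzero Xz.
      by move=> p [_ vp]; apply: vp; rewrite -hadamard_subst.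
    have outV (U : projset K n) (w : point) : proj_closed U -> (forall i, X i (w i)) ->
        (w i != 0 /\ forall p, vanishing_form U p -> p.@[(w i *m slot w i) 0] = 0) ->
        U (hadamard_point w).
      move=> cU Xw [_ Uw]; apply: closed_form => //; last by rewrite (hadamard_slot _ i).
      by have [] := hadamard_image_point Xw.
    have [|sub|sub] := irr _ _ cV' cW'.
    - move=> z Xz; apply: NNPP => /not_or_and[nVz nWz]; apply: noz; exists z.
      by split=> // ?; [apply: nVz | apply: nWz]; apply: inV.
    - by apply: nV; apply: outV => //; apply: sub.
    by apply: nW; apply: outV => //; apply: sub.
  exists (subst_at x1 i z), (subst_at y1 i z); split=> //; try exact: subst_atP.
  move=> i' i'k; rewrite /subst_at; case: eqP => // i'i; apply: E.
  rewrite ltn_neqAle -ltnS i'k andbT; apply/eqP => ik; apply: i'i; exact: val_inj.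
have [x1 [y1 [Xx1 Xy1 nV nW E]]] := step l (leqnn _).
have Exy : hadamard_point x1 = hadamard_point y1.
  by apply/rowP => j; rewrite !mxE; apply: eq_bigr => i _; rewrite E.
case: (YVW _ (hadamard_image_point Xx1)) => // Wx.
by apply: nW; rewrite -Exy.
Qed.

End Product.

Lemma hadamard_image_psubset X X' i0 :
  (forall i, proj_variety (X i)) -> (forall i, proj_variety (X' i)) ->
  (forall i z, X' i z -> (z <= A i)%MS) ->
  (forall i, psub (X i) (X' i)) -> ~ psub (X' i0) (X i0) ->
  psubset (hadamard_image X) (hadamard_image X').
Proof.
move=> vX vX' XA' sub nsub; split.
  by move=> w [w0 [x Xx E]]; split=> //; exists x => // i; apply: sub.
move=> sub'; apply: nsub => z Xz.
have /fin_all_exists[x Xx] : forall i : 'I_l, exists z, X' i z.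
  by move=> i; have [_ ? _] := vX' i.
have cX' i : proj_closed (X' i) by have [] := vX' i.
have Xxz : forall i, X' i (subst_at x i0 z i) by apply: subst_atP.
have [_ [x' Xx' E]] := sub' _ (hadamard_image_point cX' XA' Xxz).
have Ax' : in_spans x' by move=> i; apply/XA'/sub.
have [|c c0] := hadamard_inj (in_spansP XA' Xxz) Ax' _ E i0.
  by move=> i; apply: closed_nonzero (cX' i) (Xxz i).
rewrite {1}/subst_at eqxx => ->; apply: closed_scale => //.
by have [] := vX i0.
Qed.

(** A chain with prescribed top member, which can therefore be prolonged. *)
Definition chain_to (W : projset K n) d := exists Z : nat -> projset K n,
  [/\ forall i, (i <= d)%N -> proj_variety (Z i),
      forall i, (i < d)%N -> psubset (Z i) (Z i.+1) & Z d = W].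

Lemma chain_to_succ V W d : chain_to V d -> proj_variety W -> psubset V W ->
  chain_to W d.+1.
Proof.
move=> [Z [vZ sZ ZV]] vW sVW; exists (fun i => if (i <= d)%N then Z i else W); split.
- by move=> i _; case: ifP => // /vZ.
- move=> i; rewrite ltnS => id; rewrite id; case: ltnP => [|di]; first exact: sZ.
  by have -> : i = d by [apply/eqP; rewrite eqn_leq id]; rewrite ZV.
by rewrite ltnn.
Qed.

(** Lowering one of the indices by one gives a strictly smaller product, so the
    length is the sum of the indices. *)
Lemma hadamard_chain (Z : 'I_l -> nat -> projset K n) (d : 'I_l -> nat) :
  (forall i j, (j <= d i)%N -> proj_variety (Z i j)) ->
  (forall i j, (j < d i)%N -> psubset (Z i j) (Z i j.+1)) ->
  (forall i j z, (j <= d i)%N -> Z i j z -> (z <= A i)%MS) ->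
  forall e : 'I_l -> nat, (forall i, (e i <= d i)%N) ->
  chain_to (hadamard_image (fun i => Z i (e i))) (\sum_i e i).
Proof.
move=> vZ sZ ZA e; move Ns: (\sum_i e i)%N => N.
have vY e' : (forall i, (e' i <= d i)%N) ->
    proj_variety (hadamard_image (fun i => Z i (e' i))).
  move=> le; apply: hadamard_image_variety => i.
  - by have [] := vZ _ _ (le i).
  - by move=> z; apply: ZA.
  exact: vZ.
elim: N e Ns => [|N IH] e Ns le.
  by exists (fun=> hadamard_image (fun i => Z i (e i))); split=> // i _; apply: vY.
have [i ei] : exists i, (0 < e i)%N.
  apply/existsP; apply: contra_eqT Ns; rewrite negb_exists => /forallP e0.
  by rewrite big1 // => i _; apply/eqP; rewrite -leqn0 leqNgt.
pose e' i' := if i' == i then (e i).-1 else e i'.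
have le' i' : (e' i' <= d i')%N.
  by rewrite /e'; case: eqP => // ->; apply: leq_trans (le i); apply: leq_pred.
have ee' : e i = (e' i).+1 by rewrite /e' eqxx prednK.
have Ne' : (\sum_i e' i = N)%N.
  apply: succn_inj; rewrite -Ns (bigD1 i) //= [in RHS](bigD1 i) //= ee' addSn.
  by congr (_ + _).+1; apply: eq_bigr => i' /negbTE; rewrite /e' => ->.
apply: (chain_to_succ (IH e' Ne' le') (vY e le)).
apply: (@hadamard_image_psubset _ _ i).
- by move=> i'; apply: vZ.
- by move=> i'; apply: vZ.
- by move=> i' z; apply: ZA.
- move=> i'; rewrite {1}/e'; case: eqP => [->|_] z //.
  have [|sub _] := sZ i (e i).-1; first by rewrite prednK.
  by move=> /sub; rewrite prednK.
have [|_] := sZ i (e' i); first by rewrite -ee'.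
by rewrite -ee'.
Qed.

Section TangentSpace.

Variable X : 'I_l -> projset K n.
Hypotheses (cX : forall i, proj_closed (X i)) (XA : forall i z, X i z -> (z <= A i)%MS).

Variables (x : point) (d : 'I_l -> nat) (T : 'I_l -> 'M[K]_n.+1).
Hypotheses (Xx : forall i, X i (x i)) (rT : forall i, \rank (T i) = (d i).+1).
Hypothesis tanT : forall i (v : 'rV[K]_n.+1), (v <= T i)%MS <-> tangent (X i) (x i) v.

Let y := hadamard_point x.

Let Ax : in_spans x.
Proof. exact: (in_spansP XA Xx). Qed.

Lemma tangent_in_span i (v : 'rV[K]_n.+1) : (v <= T i)%MS -> (v <= A i)%MS.
Proof. by move/tanT; apply: tangent_span; apply: XA. Qed.

(** A form that vanishes on the product becomes, by substitution of the slot, a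
    form that vanishes on X i. *)
Lemma slot_tangent i (t : 'rV[K]_n.+1) : (t <= T i)%MS ->
  tangent (hadamard_image X) y (t *m slot x i).
Proof.
move=> /tanT tt p [[dp hp] vp]; rewrite -/(dderiv p y _) /y (hadamard_slot x i).
rewrite -substitute_deriv; apply: tt; split.
  by exists dp; apply: substitute_homog.
move=> z Xz; rewrite substitute_eval -hadamard_subst; apply: vp.
by apply: hadamard_image_point => //; apply: subst_atP.
Qed.

Section Witness.

Variable k : J.
Hypothesis kx : forall i, functional (x i) (lam k i) != 0.

Let c i := cofactor_at k x i.
Let b := functional y (beta k).

Let c0 i : c i != 0.
Proof. by apply/prodf_neq0 => i' _; apply: kx. Qed.

Let b0 : b != 0.
Proof. by rewrite /b (rf_coord rf) //; apply/prodf_neq0 => i' _; apply: kx. Qed.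

(** A complement in T i of the line of the point x i, chosen where the coordinate
    [lam k i] vanishes, so that slices of its slot images in the other directions
    are 0. *)
Definition normal_part i : 'M[K]_n.+1 := (T i :&: kermx (lam k i))%MS.

Lemma normal_partP i (t : 'rV[K]_n.+1) :
  reflect ((t <= T i)%MS /\ functional t (lam k i) = 0) (t <= normal_part i)%MS.
Proof.
rewrite /normal_part sub_capmx sub_kermx; apply: (iffP andP) => -[Tt].
  by move=> /eqP E; split=> //; rewrite /functional E mxE.
by move=> E; split=> //; apply/eqP/matrixP => r s; rewrite !ord1 [RHS]mxE.
Qed.

Lemma point_in_tangent i : (x i <= T i)%MS.
Proof. by apply/tanT/euler_tangent. Qed.

Lemma rank_normal_part i : \rank (normal_part i) = d i.
Proof.
have := mxrank_mul_ker (T i) (lam k i); rewrite rT.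
suff -> : \rank (T i *m lam k i) = 1%N by rewrite add1n => -[].
apply/eqP; rewrite eqn_leq rank_leq_col lt0n mxrank_eq0.
apply: contraNneq (kx i) => E; have /submxP[D ->] := point_in_tangent i.
by rewrite /functional -mulmxA E mulmx0 mxE.
Qed.

Lemma normal_subst_span i (t : 'rV[K]_n.+1) : (t <= normal_part i)%MS ->
  in_spans (subst_at x i t).
Proof.
move=> /normal_partP[/tangent_in_span At _].
by apply: (subst_atP (Q := fun i' z => (z <= A i')%MS)).
Qed.

Definition branch i := normal_part i *m slot x i.

Lemma branch_slice i : branch i *m S k i = c i *: normal_part i.
Proof.
apply/row_matrixP => r; rewrite /branch -mulmxA row_mul [RHS]linearZ /= mulmxA.
have Nt := row_sub r (normal_part i).
rewrite -hadamard_subst (rf_slice rf); last exact: normal_subst_span.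
rewrite {2}/subst_at eqxx; congr (_ *: _); apply: eq_bigr => i' /negbTE i'i.
by rewrite /subst_at i'i.
Qed.

Lemma branch_slice0 i i' : i' != i -> branch i' *m S k i = 0.
Proof.
move=> i'i; apply/row_matrixP => r; rewrite /branch -mulmxA row_mul mulmxA.
have Nt := row_sub r (normal_part i').
rewrite -hadamard_subst (rf_slice rf); last exact: normal_subst_span.
rewrite /cofactor_at (bigD1 i') //= {1}/subst_at eqxx.
by have /normal_partP[_ ->] := Nt; rewrite mul0r scale0r row0.
Qed.

Lemma branch_coord i : branch i *m beta k = 0.
Proof.
apply/row_matrixP => r; rewrite /branch -mulmxA row_mul mulmxA.
have Nt := row_sub r (normal_part i).
rewrite -hadamard_subst; apply/matrixP => r' s; rewrite !ord1.
rewrite -[LHS]/(functional _ _) (rf_coord rf); last exact: normal_subst_span.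
rewrite (bigD1 i) //= /subst_at eqxx.
by have /normal_partP[_ ->] := Nt; rewrite mul0r !mxE.
Qed.

Definition tangent_mx : 'M[K]_n.+1 := (y + \sum_i branch i)%MS.

(** The sum is direct: [beta k] separates the point from the branches, and the
    slice in direction i kills all the branches but the i-th, on which it is
    injective. *)
Lemma rank_tangent_mx : \rank tangent_mx = (\sum_i d i).+1.
Proof.
have y1 : \rank y = 1%N.
  apply/eqP; rewrite eqn_leq rank_leq_row lt0n mxrank_eq0.
  by have [] := hadamard_image_point cX XA Xx.
rewrite /tangent_mx mxrank_disjoint_sum; last first.
  apply/eqP; rewrite -submx0; apply/rV_subP => v; rewrite sub_capmx => /andP[].
  case/sub_rVP => a -> /(submxMr (beta k)).
  rewrite sumsmxMr_gen big1 => [|i _]; last by rewrite branch_coord genmx0.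
  rewrite submx0 -scalemxAl scaler_eq0 => /orP[/eqP->|/eqP yb].
    by rewrite scale0r sub0mx.
  by move: b0; rewrite /b /functional yb mxE eqxx.
rewrite y1 add1n; congr _.+1.
have rb i : \rank (branch i) = d i.
  rewrite -(rank_normal_part i); apply/eqP; rewrite eqn_leq mxrankM_maxl /=.
  by rewrite -(mxrank_scale_nz _ (c0 i)) -branch_slice mxrankM_maxl.
rewrite -(eq_bigr _ (fun i _ => rb i)); apply/mxdirectP; apply/mxdirect_sumsP => i _.
apply/eqP; rewrite -submx0; apply/rV_subP => v; rewrite sub_capmx => /andP[].
case/submxP => D -> /(submxMr (S k i)).
rewrite sumsmxMr big1 => [|i' /andP[_ i'i]]; last exact: branch_slice0.
rewrite submx0 -mulmxA branch_slice -scalemxAr scaler_eq0 (negbTE (c0 i)) /=.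
by move=> /eqP E; rewrite /branch mulmxA E mul0mx sub0mx.
Qed.

Lemma slot_sub_tangent i (t : 'rV[K]_n.+1) : (t <= T i)%MS ->
  (t *m slot x i <= tangent_mx)%MS.
Proof.
move=> Tt; pose a := functional t (lam k i) / functional (x i) (lam k i).
have Nt : (t - a *: x i <= normal_part i)%MS.
  apply/normal_partP; split.
    by rewrite addmx_sub // eqmx_opp scalemx_sub // point_in_tangent.
  by rewrite -scaleNr functionalD functionalZ mulNr divfK ?subrr.
rewrite -[t](subrK (a *: x i)) mulmxDl -scalemxAl -hadamard_slot.
rewrite addmx_sub // ?scalemx_sub ?addsmxSl //.
apply: submx_trans (addsmxSr _ _); apply: (sumsmx_sup i) => //.
exact: submxMr.
Qed.

Lemma tangent_slice i v : tangent (hadamard_image X) y v -> (v *m S k i <= T i)%MS.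
Proof.
move=> tv; apply/tanT; apply: (tangent_scale (c0 i)) => q vq.
rewrite -(rf_slice rf) // -/(dderiv q _ _) -substitute_deriv; apply: tv; split.
  by have [[dq hq] _] := vq; exists dq; apply: substitute_homog.
by move=> _ [_ [z Xz ->]]; apply: (slice_form_vanish XA k vq).
Qed.

(** A vector tangent to the product has slices tangent to the factors
    ([tangent_slice]), and the derivative of the rank one forms expresses the
    vector in terms of the point and of the slot images of its slices. *)
Lemma tangent_mxP v : (v <= tangent_mx)%MS <-> tangent (hadamard_image X) y v.
Proof.
split=> [vT|tv].
  move=> p Vp; rewrite -/(dderiv p y v).
  suff : (tangent_mx <= kermx (grad p y)^T)%MS.
    move/(submx_trans vT); rewrite sub_kermx dderivE => /eqP/matrixP/(_ 0 0).
    by rewrite !mxE eqxx mulr1n.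
  have ker (w : 'rV[K]_n.+1) : tangent (hadamard_image X) y w ->
      (w <= kermx (grad p y)^T)%MS.
    by move=> tw; rewrite sub_kermx dderivE [dderiv _ _ _](tw p Vp) raddf0.
  rewrite addsmx_sub; apply/andP; split.
    exact/ker/euler_tangent/hadamard_image_point.
  apply/sumsmx_subP => i _; apply/row_subP => r; rewrite row_mul.
  apply/ker/slot_tangent.
  by have /normal_partP[] := row_sub r (normal_part i).
pose L i j := linear_form (col j (S k i)).
have sumE j : (\sum_i (\prod_(i' | i' != i) c i') *: (v *m S k i *m slot x i)) 0 j =
    \sum_i dderiv (L i j) y v * \prod_(i' | i' != i) (L i' j).@[y 0].
  rewrite summxE; apply: eq_bigr => i _.
  rewrite linear_form_deriv functional_col mxE mul_mx_diag mxE [(\row_ _ _) 0 j]mxE.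
  rewrite mulrCA -big_split; congr (_ * _); apply: eq_bigr => i' _.
  by rewrite linear_form_eval functional_col (rf_slice rf) // [in RHS]mxE.
(* The derivatives in direction v of the rank one forms, for all j at once. *)
have bv : b ^+ l.-1 *: v =
    \sum_i (\prod_(i' | i' != i) c i') *: (v *m S k i *m slot x i)
    - (l.-1%:R * b ^+ l.-2 * functional v (beta k)) *: y.
  apply/rowP => j; rewrite [LHS]mxE [RHS]mxE sumE [X in _ = _ + X]mxE [X in _ = _ - X]mxE.
  have : dderiv (rank_one_form k j) y v = 0.
    apply: tv; split; first by exists l; apply: rank_one_form_homog.
    by move=> _ [_ [z Xz ->]]; apply/rank_one_form_vanish/(in_spansP XA Xz).
  rewrite dderivB dderivM dderivX_exp rmorphXn /= !linear_form_eval linear_form_deriv.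
  rewrite dderivX mevalXU dderiv_prod => /eqP; rewrite subr_eq0 => /eqP <-.
  by rewrite -/b; ring.
have bl : b ^+ l.-1 != 0 by rewrite expf_neq0.
have -> : v = (b ^+ l.-1)^-1 *: (b ^+ l.-1 *: v) by rewrite scalerA mulVf // scale1r.
apply: scalemx_sub; rewrite bv addmx_sub //.
  apply: summx_sub => i _; apply/scalemx_sub/slot_sub_tangent.
  exact: tangent_slice.
by rewrite eqmx_opp scalemx_sub // addsmxSl.
Qed.

End Witness.

Lemma hadamard_tangent : exists2 T' : 'M[K]_n.+1, \rank T' = (\sum_i d i).+1 &
  forall v : 'rV[K]_n.+1, (v <= T')%MS <-> tangent (hadamard_image X) y v.
Proof.
have [k kx] := rf_separate rf Ax (fun i => closed_nonzero (cX i) (Xx i)).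
by exists (tangent_mx k); [exact: rank_tangent_mx | exact: tangent_mxP].
Qed.

End TangentSpace.

(** The chains of the factors give the lower bound on the dimension, the rank of
    the tangent spaces gives the upper bound. *)
Lemma hadamard_image_nonsingular X :
  (forall i, proj_variety (X i)) -> (forall i z, X i z -> (z <= A i)%MS) ->
  (forall i, nonsingular (X i)) -> nonsingular (hadamard_image X).
Proof.
move=> vX XA nsX; have cX i : proj_closed (X i) by have [] := vX i.
have /fin_all_exists[d dP] : forall i : 'I_l, exists d, has_dim (X i) d /\
    forall z, X i z -> exists2 T : 'M[K]_n.+1, \rank T = d.+1 &
      forall v : 'rV[K]_n.+1, (v <= T)%MS <-> tangent (X i) z v.
  by move=> i; have [d ? ?] := nsX i; exists d.
have tan y : hadamard_image X y -> exists2 T : 'M[K]_n.+1, \rank T = (\sum_i d i).+1 &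
    forall v : 'rV[K]_n.+1, (v <= T)%MS <-> tangent (hadamard_image X) y v.
  move=> [_ [x Xx ->]].
  have /fin_all_exists[T TP] : forall i : 'I_l, exists T : 'M[K]_n.+1,
      \rank T = (d i).+1 /\ forall v : 'rV[K]_n.+1, (v <= T)%MS <-> tangent (X i) (x i) v.
    by move=> i; have [_ /(_ _ (Xx i))[T ? ?]] := dP i; exists T.
  apply: (hadamard_tangent cX XA (T := T) Xx) => i; first by have [] := TP i.
  by have [_ +] := TP i; apply.
exists (\sum_i d i)%N => //; split; last first.
  by move=> e ch; rewrite -ltnS; apply: chain_lt_tangent ch tan.
have /fin_all_exists[Z ZP] : forall i : 'I_l, exists Z : nat -> projset K n,
    [/\ forall j, (j <= d i)%N -> proj_variety (Z j),
        forall j, (j < d i)%N -> psubset (Z j) (Z j.+1) & psub (Z (d i)) (X i)].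
  by move=> i; have [[[Z ?] _] _] := dP i; exists Z.
have ZX i j z : (j <= d i)%N -> Z i j z -> X i z.
  have [vZ sZ ZX] := ZP i => jd Zz; apply: ZX.
  move: (subnK jd) Zz; move: (d i - j)%N => k.
  elim: k j {jd} => [|k IH] j E Zz; first by rewrite -E.
  apply: (IH j.+1); first by rewrite addnS -addSn.
  by have [|+ _] := sZ j; [rewrite -E addSn ltnS leq_addl | apply].
have [|||W [vW sW Wd]] := @hadamard_chain Z d _ _ _ d (fun i => leqnn _).
- by move=> i; have [] := ZP i.
- by move=> i; have [] := ZP i.
- by move=> i j z jd /(ZX _ _ _ jd); apply: XA.
exists W; split=> //; rewrite Wd => w [w0 [x Zx E]]; split=> //; exists x => // i.
exact: ZX (leqnn _) (Zx i).
Qed.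

End Factors.

(** * Generic spans and the Segre embedding *)

Section Segre.

Variables (n l : nat) (h : 'I_l -> nat).

(** The coordinates of the space of tensors. *)
Definition multi_index : finType := fprod (fun i : 'I_l => 'I_(h i).+1 : finType).

Definition segre_mx (R : comNzRingType) (A : forall i, 'M[R]_((h i).+1, n.+1)) :
    'M[R]_(#|multi_index|, n.+1) :=
  \matrix_(k, j) \prod_i A i ((enum_val k : multi_index) i) j.

Lemma prod_sum_multi_index (R : comNzRingType) (F : forall i, 'I_(h i).+1 -> R) :
  \prod_i \sum_a F i a = \sum_(t : multi_index) \prod_i F i (t i).
Proof.
under eq_bigr => i _ do rewrite (@big_tag _ _ _ _ (fun i => 'I_(h i).+1 : finType)).
rewrite bigA_distr_big_dep.
pose G i : {ffun 'I_(h i).+1 -> R} := [ffun a => F i a].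
transitivity (\sum_(t : multi_index) \prod_i G i (t i)); last first.
  by apply: eq_bigr => t _; apply: eq_bigr => i _; rewrite ffunE.
rewrite [RHS](@big_fprod _ 0 1 *%R +%R _ (fun i : 'I_l => 'I_(h i).+1 : finType) G).
apply: eq_bigr => g _; apply: eq_bigr => i _.
by rewrite /untag; case: eqP => // e; rewrite ffunE.
Qed.

Lemma hadamard_segre (K : closedFieldType) (A : param_tuple K n h)
    (u : forall i, 'rV[K]_(h i).+1) :
  hadamard_point (fun i => u i *m A i) =
  (\row_k \prod_i u i 0 ((enum_val k : multi_index) i)) *m segre_mx A.
Proof.
apply/rowP => j; rewrite !mxE; under eq_bigr do rewrite mxE.
rewrite prod_sum_multi_index (reindex_onto enum_val enum_rank) => [|t _] /=; last first.
  exact: enum_rankK.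
under eq_bigl do rewrite enum_valK eqxx.
by apply: eq_bigr => k _; rewrite !mxE -big_split.
Qed.

Section Recovery.

Variables (K : closedFieldType) (A : param_tuple K n h).
Variables (C : forall i, 'M[K]_(n.+1, (h i).+1)) (B : 'M[K]_(n.+1, #|multi_index|)).
Hypotheses (AC : forall i, A i *m C i = 1%:M) (MB : segre_mx A *m B = 1%:M).

Definition replace_index (t : multi_index) i (a : 'I_(h i).+1) : multi_index :=
  fprod_of_fun (dfwith t a).

(** The coordinates along the line through t in direction i, read in the basis of
    the i-th span given by the rows of A i. *)
Definition slice_mx (t : multi_index) i : 'M[K]_n.+1 :=
  colsub (fun a => enum_rank (replace_index t a)) B *m A i.

Lemma segre_coord u t :
  (hadamard_point (fun i => u i *m A i) *m B) 0 (enum_rank t) = \prod_i u i 0 (t i).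
Proof.
by rewrite hadamard_segre -mulmxA MB mulmx1 mxE enum_rankK.
Qed.

(** A right inverse B of the Segre matrix gives the coordinates of tensors, right
    inverses C i of the A i give the coordinates of points of the spans. *)
Lemma segre_recovers : recovers_factors A
  (fun (t : multi_index) i => col (t i) (C i)) (fun t => col (enum_rank t) B)
  slice_mx (1%:M - B *m segre_mx A).
Proof.
have param x : in_spans A x -> forall i, x i *m C i *m A i = x i.
  by move=> Ax i; have /submxP[D ->] := Ax i; rewrite -(mulmxA D) AC mulmx1.
have hadE x : in_spans A x ->
    hadamard_point x = hadamard_point (fun i => x i *m C i *m A i).
  move=> Ax; apply/rowP => j; rewrite !mxE; apply: eq_bigr => i _.
  by rewrite param.
have coord x t : in_spans A x ->
    (hadamard_point x *m B) 0 (enum_rank t) = \prod_i (x i *m C i) 0 (t i).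
  by move=> Ax; rewrite hadE // segre_coord.
split.
- move=> t x Ax; rewrite functional_col coord //.
  by apply: eq_bigr => i _; rewrite functional_col.
- move=> t i x Ax; rewrite /slice_mx mulmxA.
  have -> : hadamard_point x *m colsub (fun a => enum_rank (replace_index t a)) B =
      cofactor_at (fun (t : multi_index) i => col (t i) (C i)) t x i *: (x i *m C i).
    apply/rowP => a; rewrite mulmx_colsub mxE coord // [RHS]mxE mulrC.
    rewrite (bigD1 i) //= fprodE dfwith_in; congr (_ * _).
    apply: eq_bigr => i' i'i; rewrite functional_col fprodE dfwith_out //.
    by rewrite eq_sym.
  by rewrite -scalemxAl param.
- move=> x Ax x0.
  have /fin_all_exists[a aP] : forall i : 'I_l, exists a, (x i *m C i) 0 a != 0.
    move=> i; apply/existsP; apply: contraNT (x0 i).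
    rewrite negb_exists => /forallP z; rewrite -(param x Ax i).
    have -> : x i *m C i = 0 by apply/rowP => a; rewrite [RHS]mxE; apply/eqP/negPn.
    by rewrite mul0mx.
  by exists (fprod_of_fun a) => i; rewrite functional_col fprodE.
- move=> x Ax; rewrite hadE // hadamard_segre mulmxBr mulmx1.
  by rewrite -mulmxA [segre_mx A *m _]mulmxA MB mul1mx subrr.
move=> y y0 yP.
have yE : y = y *m B *m segre_mx A.
  by apply/eqP; rewrite -subr_eq0 -mulmxA -[X in X - _]mulmx1 -mulmxBr yP.
have /existsP[k yk] : [exists k, (y *m B) 0 k != 0].
  apply: contraNT y0; rewrite negb_exists => /forallP z; rewrite yE.
  have -> : y *m B = 0 by apply/rowP => k; rewrite [RHS]mxE; apply/eqP/negPn.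
  by rewrite mul0mx.
by exists (enum_val k); rewrite functional_col enum_valK.
Qed.

End Recovery.

Section Genericity.

Variable K : closedFieldType.

Notation N := ((\sum_(i < l) (h i).+1) * n.+1)%N.

Definition generic_coords : 'M[{mpoly K[N]}]_(\sum_(i < l) (h i).+1, n.+1) :=
  \matrix_(r, j) 'X_(mxvec_index r j).

(** A polynomial in the coefficients of the parametric equations.  Since a matrix
    has full row rank exactly when some product with a constant matrix B has
    nonzero determinant, these polynomials define the open set of good
    tuples. *)
Definition segre_minor (B : 'M[K]_(n.+1, #|multi_index|)) : {mpoly K[N]} :=
  \det (segre_mx (fun i => submxcol generic_coords i) *m map_mx (@mpolyC N K) B).

Lemma segre_minor_eval (A : param_tuple K n h) B :
  (segre_minor B).@[param_coords A 0] = \det (segre_mx A *m B).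
Proof.
rewrite /segre_minor -[LHS]/((meval (param_coords A 0)) _) -det_map_mx map_mxM.
congr (\det (_ *m _)); last by apply/matrixP => j k; rewrite !mxE /= mevalC.
apply/matrixP => k j; rewrite !mxE rmorph_prod; apply: eq_bigr => i _ /=.
rewrite 2!mxE mevalXU /param_coords mxvecE.
by have /matrixP/(_ ((enum_val k : multi_index) i) j) := mxcolK A i; rewrite mxE.
Qed.

Lemma segre_open : param_open (fun A : param_tuple K n h => row_free (segre_mx A)).
Proof.
exists (fun p => exists B, p = segre_minor B) => A; split.
  case/row_freeP => B MB; exists (segre_minor B); first by exists B.
  by rewrite segre_minor_eval MB det1 oner_neq0.
case=> _ [B ->]; rewrite segre_minor_eval -unitfE -unitmxE => /mxrank_unit rM.
by rewrite /row_free eqn_leq rank_leq_row -[X in (X <= _)%N]rM mxrankM_maxl.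
Qed.

Hypothesis hn : (#|multi_index| <= n.+1)%N.

(** A tuple in the open set.  The k-th coordinate point of P^n is made the product
    of basis vectors of the spans selected by the k-th multi-index, so that the
    Segre matrix is the identity followed by further columns. *)
Definition coordinate_tuple : param_tuple K n h := fun i =>
  \matrix_(a, j)
    if insub (val j) is Some k
    then ((enum_val (k : 'I_#|multi_index|) : multi_index) i == a)%:R else 0.

Lemma coordinate_tupleE i a (k : 'I_#|multi_index|) :
  coordinate_tuple i a (widen_ord hn k) = ((enum_val k : multi_index) i == a)%:R.
Proof. by rewrite mxE /= valK. Qed.

Lemma segre_coordinate : row_free (segre_mx coordinate_tuple).
Proof.
apply/row_freeP; exists (\matrix_(j, k) (j == widen_ord hn k)%:R).
apply/matrixP => k k'; rewrite !mxE (bigD1 (widen_ord hn k')) //= big1 => [|j]; last first.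
  by move/negbTE => jk; rewrite [X in _ * X]mxE jk mulr0.
rewrite addr0 [X in _ * X]mxE eqxx mulr1 mxE.
under eq_bigr do rewrite coordinate_tupleE.
have [->|kk'] := eqVneq k k'; first by apply: big1 => i _; rewrite eqxx.
have [i ki] : exists i, (enum_val k' : multi_index) i != (enum_val k : multi_index) i.
  apply/existsP; apply: contra_neqT kk'; rewrite negb_exists => /forallP e.
  by apply/enum_val_inj/fprodP => i; apply/esym/eqP/negPn.
by rewrite (bigD1 i) //= (negbTE ki) mul0r.
Qed.

Lemma span_coordinate : span_tuple coordinate_tuple.
Proof.
move=> i; apply/row_freeP.
pose t (a : 'I_(h i).+1) : multi_index :=
  fprod_of_fun (dfwith (fun i' => ord0 : 'I_(h i').+1) a).
exists (\matrix_(j, a) (j == widen_ord hn (enum_rank (t a)))%:R).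
apply/matrixP => a a'; rewrite !mxE (bigD1 (widen_ord hn (enum_rank (t a')))) //=.
rewrite big1 => [|j]; last by move/negbTE => jk; rewrite [X in _ * X]mxE jk mulr0.
rewrite addr0 [X in _ * X]mxE eqxx mulr1 coordinate_tupleE enum_rankK.
by rewrite fprodE dfwith_in eq_sym.
Qed.

End Genericity.

End Segre.

Lemma nonsingular_ext (K : closedFieldType) n (X Y : projset K n) :
  (forall x, X x <-> Y x) -> nonsingular X -> nonsingular Y.
Proof.
move=> XY [d [[Z [vZ sZ ZX]] dmax] tX]; exists d.
  split; first by exists Z; split=> // z /ZX/XY.
  by move=> e [Z' [vZ' sZ' Z'Y]]; apply: dmax; exists Z'; split=> // z /Z'Y/XY.
have vXY p : vanishing_form X p <-> vanishing_form Y p.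
  by split=> -[fp vp]; split=> // x /XY; apply: vp.
move=> x /XY/tX[T rT TP]; exists T => // v; rewrite TP.
by split=> tv p /vXY; apply: tv.
Qed.

Lemma hadamardE (K : closedFieldType) n l (X : 'I_l -> projset K n) :
  proj_closed (hadamard_image X) ->
  forall x, hadamard_image X x <-> hadamard X x.
Proof. by move=> cX x; split=> [Xx Z _ | Xx]; [apply | apply: Xx]. Qed.

Theorem mainTheorem2 (K : closedFieldType) (charK0 : [pchar K] =i pred0)
    (n l : nat) (h : 'I_l -> nat) (l_gt0 : (0 < l)%N)
    (hn : (\prod_(i < l) (h i).+1 - 1 <= n)%N) :
  generically (fun A : param_tuple K n h =>
    forall X : 'I_l -> projset K n,
      (forall i, proj_variety (X i)) ->
      (forall i, has_linear_span (X i) (A i)) ->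
      (forall i, nonsingular (X i)) ->
      nonsingular (hadamard X)).
Proof.
have cardN : (#|multi_index h| <= n.+1)%N.
  rewrite /multi_index card_fprod; under eq_bigr do rewrite card_ord.
  by rewrite leq_subLR add1n in hn.
exists (fun A => row_free (segre_mx A)); split; first exact: segre_open.
  exists (@coordinate_tuple n l h K); first exact: span_coordinate cardN.
  exact: segre_coordinate cardN.
move=> A sA /row_freeP[B MB] X vX spX nsX.
have /fin_all_exists[C AC] : forall i, exists C : 'M[K]_(n.+1, (h i).+1), A i *m C = 1%:M.
  by move=> i; apply/row_freeP/sA.
have rf := segre_recovers AC MB.
have XA i z : X i z -> (z <= A i)%MS by have [+ _] := spX i; apply.
have cX i : proj_closed (X i) by have [] := vX i.
apply: nonsingular_ext (hadamard_image_nonsingular l_gt0 rf vX XA nsX).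
by apply: hadamardE; apply: (hadamard_image_closed l_gt0 rf cX XA).
Qed.
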